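(* There is an algorithm which, given a triangular system of polynomials $\overline{P}=(P_1,\ldots,P_k)$ over $\mathbf{K}$, $$P_1(X_1)\in\mathbf{K}[X_1],\; P_2(X_1,X_2)\in\mathbf{K}[X_1,X_2],\;\ldots,\;P_k(X_1,\ldots,X_k)\in\mathbf{K}[X_1,\ldots,X_k],$$ and a finite list of polynomials $Q_1,\ldots,Q_r\in\mathbf{K}[X_1,\ldots,X_k]$, computes the multiset of $(k+r)$-tuples of values $$\left[\left(v(x_1),\ldots,v(x_k),v(Q_1(\overline{x})),\ldots,v(Q_r(\overline{x}))\right)\right]_{\overline{x}=(x_1,\ldots,x_k)\in R},$$ where $R$ is the multiset of root vectors of $\overline{P}$ in $(\mathbf{K}^{\rm ac})^k$ (a multiset of cardinality $\prod_i\deg_{X_i}(P_i)$).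
   Context: $\mathbf{K}$ is a valued field with valuation ring $\mathbf{V}$, and $\mathbf{S}\subseteq\mathbf{V}$ is a subring whose quotient field is $\mathbf{K}$. Computability assumptions: $\mathbf{S}$ is an explicit ring (its algebraic operations and equality test are explicit), and for any two elements of $\mathbf{S}$ one can test whether one divides the other in $\mathbf{V}$; no polynomial factorization algorithm is assumed. $\mathbf{K}^{\rm ac}$ is the algebraic closure of $\mathbf{K}$ with a valuation ring $\mathbf{V}^{\rm ac}$ extending $\mathbf{V}$; $v$ is the corresponding valuation on $\mathbf{K}^{\rm ac}$, with value group the divisible hull of the value group of $\mathbf{K}$, and $v(0)=\infty$. A value $v(x)$, $x\in\mathbf{K}^{\rm ac}$, is computed when one knows an integer $m\ge 1$ and elements $f\neq 0$, $g$ of $\mathbf{S}$, given as integer polynomials in the coefficients of the problem, such that $f x^m=ug$ for some unit $u$ of $\mathbf{V}^{\rm ac}$, i.e. $m\,v(x)=v(g)-v(f)$. A system $(P_1,\ldots,P_k)$ as displayed is triangular if each $P_i$ is monic with respect to $X_i$. A root vector is $(x_1,\ldots,x_k)\in(\mathbf{K}^{\rm ac})^k$ with $P_1(x_1)=P_2(x_1,x_2)=\cdots=P_k(x_1,\ldots,x_k)=0$; the multiset of root vectors is obtained by taking successively $x_1$ in the multiset of roots of $P_1(X_1)$, $x_2$ in the multiset of roots of $P_2(x_1,X_2)$, and so on, with multiplicities. A multiset is a list up to permutation. *)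

(* Defs.v *)
From mathcomp Require Import all_boot all_order all_algebra.
From mathcomp Require Import mpoly.

Set Implicit Arguments.
Unset Strict Implicit.
Unset Printing Implicit Defensive.

Import GRing.Theory.
Local Open Scope ring_scope.

(* ** Integer polynomials in indeterminates c_0, c_1, ..., as arithmetic
   expressions, and their value in a ring at a list of elements. *)

Inductive intpoly : Type :=
| IVar of nat
| IZero
| IOne
| IAdd of intpoly & intpoly
| IOpp of intpoly
| IMul of intpoly & intpoly.

Fixpoint ieval (S : comNzRingType) (c : seq S) (e : intpoly) : S :=
  match e with
  | IVar n => c`_n
  | IZero => 0
  | IOne => 1
  | IAdd e1 e2 => ieval c e1 + ieval c e2
  | IOpp e1 => - ieval c e1
  | IMul e1 e2 => ieval c e1 * ieval c e2
  end.

(* ** Algorithms over an explicit ring with a divisibility test.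

   An algorithm is a finite piece of syntax, containing no element of the ring.
   It accesses the ring only through the constants 0 and 1, the operations
   +, - and *, the equality test and one binary test (below: divisibility in
   the valuation ring); it has no access to quotients.  Everything else is
   ordinary computation with naturals, pairs, sums, lists and formal integer
   polynomials. *)

Inductive ty : Type :=
| TUnit
| TNat
| TRing
| TIntPoly
| TProd of ty & ty
| TSum of ty & ty
| TList of ty.

(* inl tt stands for true and inr tt for false. *)
Definition TBool := TSum TUnit TUnit.

Fixpoint tyden (S : Type) (t : ty) : Type :=
  match t with
  | TUnit => unit
  | TNat => nat
  | TRing => S
  | TIntPoly => intpoly
  | TProd a b => (tyden S a * tyden S b)%type
  | TSum a b => (tyden S a + tyden S b)%type
  | TList a => seq (tyden S a)
  end.

(* First-order terminating programs, in combinator form: [G] is a context of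
   parameters.  [PNatRec] and [PListRec] are primitive recursion. *)
Inductive prog : ty -> ty -> Type :=
| PId A : prog A A
| PComp A B C : prog B C -> prog A B -> prog A C
| PTt A : prog A TUnit
| PPair A B C : prog A B -> prog A C -> prog A (TProd B C)
| PFst A B : prog (TProd A B) A
| PSnd A B : prog (TProd A B) B
| PInl A B : prog A (TSum A B)
| PInr A B : prog B (TSum A B)
| PCase G A B C :
    prog (TProd G A) C -> prog (TProd G B) C -> prog (TProd G (TSum A B)) C
| PO : prog TUnit TNat
| PSucc : prog TNat TNat
| PNatRec G A :
    prog G A -> prog (TProd G (TProd TNat A)) A -> prog (TProd G TNat) A
| PNil A : prog TUnit (TList A)
| PCons A : prog (TProd A (TList A)) (TList A)
| PListRec G A B :
    prog G B -> prog (TProd G (TProd A (TProd (TList A) B))) B ->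
    prog (TProd G (TList A)) B
| PZero : prog TUnit TRing
| POne : prog TUnit TRing
| PAdd : prog (TProd TRing TRing) TRing
| POpp : prog TRing TRing
| PMul : prog (TProd TRing TRing) TRing
| PEq : prog (TProd TRing TRing) TBool
| PDvd : prog (TProd TRing TRing) TBool
| PIVar : prog TNat TIntPoly
| PIZero : prog TUnit TIntPoly
| PIOne : prog TUnit TIntPoly
| PIAdd : prog (TProd TIntPoly TIntPoly) TIntPoly
| PIOpp : prog TIntPoly TIntPoly
| PIMul : prog (TProd TIntPoly TIntPoly) TIntPoly
| PIEval : prog (TProd (TList TRing) TIntPoly) TRing.

Definition bool_sum (b : bool) : unit + unit := if b then inl tt else inr tt.

Fixpoint nat_primrec (A : Type) (z : A) (s : nat -> A -> A) (n : nat) : A :=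
  if n is n'.+1 then s n' (nat_primrec z s n') else z.

Fixpoint seq_primrec (A B : Type) (z : B) (s : A -> seq A -> B -> B)
    (l : seq A) : B :=
  if l is a :: l' then s a l' (seq_primrec z s l') else z.

Fixpoint pden (S : comNzRingType) (dvd : rel S) (A B : ty) (p : prog A B) :
    tyden S A -> tyden S B :=
  match p in prog A B return tyden S A -> tyden S B with
  | PId _ => fun x => x
  | PComp _ _ _ q r => fun x => pden dvd q (pden dvd r x)
  | PTt _ => fun=> tt
  | PPair _ _ _ q r => fun x => (pden dvd q x, pden dvd r x)
  | PFst _ _ => fun x => x.1
  | PSnd _ _ => fun x => x.2
  | PInl _ _ => fun x => inl x
  | PInr _ _ => fun x => inr x
  | PCase _ _ _ _ q r => fun x =>
      match x.2 with
      | inl a => pden dvd q (x.1, a)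
      | inr b => pden dvd r (x.1, b)
      end
  | PO => fun=> 0%N
  | PSucc => fun n => n.+1
  | PNatRec _ _ q r => fun x =>
      nat_primrec (pden dvd q x.1) (fun n a => pden dvd r (x.1, (n, a))) x.2
  | PNil _ => fun=> [::]
  | PCons _ => fun x => x.1 :: x.2
  | PListRec _ _ _ q r => fun x =>
      seq_primrec (pden dvd q x.1)
        (fun a l b => pden dvd r (x.1, (a, (l, b)))) x.2
  | PZero => fun=> 0
  | POne => fun=> 1
  | PAdd => fun x => x.1 + x.2
  | POpp => fun x => - x
  | PMul => fun x => x.1 * x.2
  | PEq => fun x => bool_sum (x.1 == x.2)
  | PDvd => fun x => bool_sum (dvd x.1 x.2)
  | PIVar => fun n => IVar n
  | PIZero => fun=> IZero
  | PIOne => fun=> IOne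
  | PIAdd => fun x => IAdd x.1 x.2
  | PIOpp => fun x => IOpp x
  | PIMul => fun x => IMul x.1 x.2
  | PIEval => fun x => ieval x.1 x.2
  end.

(* A general (Turing-complete relative to the ring) algorithm is a transition
   system: the step program is iterated, without any a priori bound, until it
   returns an output. *)
Record algorithm (A B : ty) : Type := Algorithm {
  state : ty;
  init : prog A state;
  step : prog state (TSum state B)
}.

Fixpoint run (S : comNzRingType) (dvd : rel S) (A B : ty) (a : algorithm A B)
    (fuel : nat) (s : tyden S (state a)) : option (tyden S B) :=
  if fuel is fuel'.+1 then
    match pden dvd (step a) s with
    | inl s' => run dvd fuel' s'
    | inr b => Some b
    end
  else None.

(* On input [x], the algorithm [a] halts with output [y]. *)
Definition outputs (S : comNzRingType) (dvd : rel S) (A B : ty)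
    (a : algorithm A B) (x : tyden S A) (y : tyden S B) : Prop :=
  exists fuel, run dvd fuel (pden dvd (init a) x) = Some y.

(* ** Input and output formats. *)

(* A polynomial over Frac(S): a list of terms (exponents, (a, b)), each one
   standing for (a / b) * X^exponents.  Repeated monomials and zero
   coefficients are allowed. *)
Definition TPoly := TList (TProd (TList TNat) (TProd TRing TRing)).
(* the system (P_1, ..., P_k) and the list (Q_1, ..., Q_r) *)
Definition TInput := TProd (TList TPoly) (TList TPoly).
(* a value, given by (m, (f, g)) *)
Definition TValue := TProd TNat (TProd TIntPoly TIntPoly).
(* a multiset, as a list, of tuples of values *)
Definition TOutput := TList (TList TValue).

(* The coefficients of the problem: all numerators and denominators of the
   input, in order of appearance. *)
Definition coefficients (S : Type) (d : tyden S TInput) : seq S :=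
  flatten [seq flatten [seq [:: t.2.1; t.2.2] | t <- p] | p <- d.1 ++ d.2].

Definition presents (S : comNzRingType) (K : fieldType) (iota : S -> K)
    (n : nat) (t : tyden S TPoly) (P : {mpoly K[n]}) : Prop :=
  all (fun c : seq nat * (S * S) => (size c.1 == n) && (c.2.2 != 0)) t
  /\ P = \sum_(c <- t) (iota c.2.1 / iota c.2.2) *:
           'X_[[multinom nth 0%N c.1 j | j < n]].

(* ** Valuation rings and values. *)

Definition is_valuation_ring (F : fieldType) (V : {pred F}) : Prop :=
  subring_closed V /\ forall x : F, x \in V \/ x^-1 \in V.

Definition is_unit_of (F : fieldType) (V : {pred F}) (u : F) : Prop :=
  [/\ u != 0, u \in V & u^-1 \in V].

(* The triple (m, (f, g)), with f and g integer polynomials in c, computes the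
   value of x, i.e. m v(x) = v(g) - v(f). *)
Definition computes_value (S : comNzRingType) (L : fieldType) (j : S -> L)
    (VL : {pred L}) (c : seq S) (w : tyden S TValue) (x : L) : Prop :=
  let m := w.1 in
  let f := ieval c w.2.1 in
  let g := ieval c w.2.2 in
  [/\ (1 <= m)%N, f != 0
    & exists2 u, is_unit_of VL u & j f * x ^+ m = u * j g].

(* ** Triangular systems and their root vectors.

   P_(i+1) is [P i : {mpoly K[i.+1]}], so that the system is (P 0, ..., P k.-1);
   [muni] views it as a polynomial in its last variable. *)

Section RootVectors.
Variables (K : fieldType) (L : closedFieldType) (phi : {rmorphism K -> L}).

Definition triangular (k : nat) (P : forall i : 'I_k, {mpoly K[i.+1]}) : Prop :=
  forall i : 'I_k, muni (P i) \is monic.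

Definition main_degree (n : nat) (p : {mpoly K[n.+1]}) : nat :=
  (size (muni p)).-1.

Definition eval_at (n : nat) (p : {mpoly K[n]}) (x : seq L) : L :=
  mmap phi (fun j : 'I_n => x`_j) p.

(* p(x_1, ..., x_n, X) *)
Definition specialize (n : nat) (p : {mpoly K[n.+1]}) (x : seq L) : {poly L} :=
  map_poly (mmap phi (fun j : 'I_n => x`_j)) (muni p).

(* the multiset of roots, with multiplicities *)
Definition roots_of (p : {poly L}) : seq L := sval (closed_field_poly_normal p).

Definition root_vectors (k : nat) (P : forall i : 'I_k, {mpoly K[i.+1]}) :
    seq (seq L) :=
  foldl (fun R i => [seq rcons x a | x <- R, a <- roots_of (specialize (P i) x)])
    [:: [::]] (enum 'I_k).

End RootVectors.

(* Main.v *)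
Require Import Defs.
From mathcomp Require Import all_boot all_order all_algebra.
From mathcomp Require Import mpoly.
From mathcomp Require Import ring zify.
From Stdlib Require List.
From Stdlib Require Import FunctionalExtensionality.

Set Implicit Arguments.
Unset Strict Implicit.
Unset Printing Implicit Defensive.

Import Defs GRing.Theory.
Local Open Scope ring_scope.

(* For a polynomial [h] in X_1, ..., X_k, eliminating X_k, ..., X_1 from T - h
   by norms (determinants of h evaluated at companion matrices) gives
   chi_h(T) = prod_x (T - h(x)), x ranging over the root vectors.  The number of
   x with v(h(x)) = gamma is the length of the edge of slope gamma of the Newton
   polygon of chi_h, read off by divisibility tests.

   For joint values of h_1, ..., h_n: the finite candidates for v(h_i(x)) are the
   slopes of chi_(h_i); the value infinity is detected by another polynomial,
   q(h_i) with chi_(h_i) = T^s q(T) and q(0) <> 0, which takes the value q(0) where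
   h_i vanishes and 0 elsewhere.  Two lists of candidates (g, gamma), (g', gamma')
   are merged into (g g'^N, gamma + N gamma'), for an N such that the sums are
   equal only when both terms are; such an N exists because the value group is
   torsion-free, each pair of sums excluding at most one N.  After n merges, the
   multiplicity of a tuple is the number of x with v(g(x)) = gamma for a single
   polynomial g. *)

(** The roots lie in a closure without explicit arithmetic, so every test has to be made on
    quantities symmetric in the root vectors, such as the coefficients of chi_h. The separate
    multisets of values of the x_i and Q_j(x) do not tell which values occur at the same root
    vector; this is why a whole tuple is encoded by one polynomial. Infinity cannot be merged as it
    is: where one factor vanishes, g g'^N vanishes whatever the other factor is. With q(h), every
    component, even an infinite one, is recognized by a finite value. Coefficients stay fractions of
    formal integer polynomials, because the output consists of such polynomials and [S] has no
    division; only the zero and divisibility tests evaluate them. [solve] is an ordinary function;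
    its transcription [p_solve] is a single piece of syntax serving all rings at once. *)

(** * The algorithm, on symbolic data *)

Definition fexpr := (intpoly * intpoly)%type.
(* sparse polynomials: a monomial is the list of the indices of its variables,
   with repetitions *)
Definition spoly := seq (seq nat * fexpr).
(** The format [(m, (f, g))] of [TValue]. Read as a fraction, [f / g] has the value [- m v(x)]; this
    explains the swapped pairs in [weights], [slope] and [entries]. *)
Definition value := (nat * fexpr)%type.
(* [(g, (w, out))] stands for the root vectors x such that v(g(x)) = w; their
   tuple of values is [out] *)
Definition entry := (spoly * (value * seq value))%type.

Definition maxsat (P : pred nat) (n : nat) : nat :=
  nat_primrec 0%N (fun i m => if P i.+1 then i.+1 else m) n.

Definition f0 : fexpr := (IZero, IOne).
Definition f1 : fexpr := (IOne, IOne).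
Definition fmul (x y : fexpr) : fexpr := (IMul x.1 y.1, IMul x.2 y.2).
Definition fadd (x y : fexpr) : fexpr :=
  (IAdd (IMul x.1 y.2) (IMul y.1 x.2), IMul x.2 y.2).
Definition fexp (x : fexpr) (n : nat) : fexpr := iter n (fmul x) f1.

Definition vmul (w w' : value) : value :=
  ((w.1 * w'.1)%N, fmul (fexp w.2 w'.1) (fexp w'.2 w.1)).
Definition vexp (w : value) (n : nat) : value := (w.1, fexp w.2 n).

Definition spcst (x : fexpr) : spoly := [:: ([::], x)].
Definition spvar (i : nat) : spoly := [:: ([:: i], f1)].
Definition spmul (p q : spoly) : spoly :=
  flatten [seq [seq (t.1 ++ u.1, fmul t.2 u.2) | u <- q] | t <- p].
Definition spopp (p : spoly) : spoly := spmul (spcst (IOpp IOne, IOne)) p.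
Definition spexp (p : spoly) (n : nat) : spoly := iter n (spmul p) (spcst f1).

Definition strip (i : nat) (m : seq nat) := [seq l <- m | l != i].
Definition deg_in (i : nat) (m : seq nat) := count (fun l => l == i) m.
Definition coef_in (i n : nat) (p : spoly) : spoly :=
  [seq (strip i t.1, t.2) | t <- p & deg_in i t.1 == n].
Definition maxlen (p : spoly) : nat := size (flatten [seq t.1 | t <- p]).

Fixpoint picks (J : seq nat) : seq (intpoly * (nat * seq nat)) :=
  if J is a :: l then
    (IOne, (a, l)) :: [seq (IOpp q.1, (q.2.1, a :: q.2.2)) | q <- picks l]
  else [::].

(* Laplace expansion along one row: each [(q, J)] consists of a product of entries
   of the previous rows and of the list of columns not used yet *)
Definition expand (row : nat -> spoly) (st : seq (spoly * seq nat)) :=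
  flatten [seq [seq (spmul (spmul (spcst (q.1, IOne)) s.1) (row q.2.1), q.2.2)
    | q <- picks s.2] | s <- st].

(** Multiplication by [X_i] on coordinates modulo [p], monic of degree [d] in [X_i]: the coordinates
    are shifted, and [X_i^d] is replaced by minus the lower terms of [p]. *)
Definition mulx (i : nat) (p : spoly) (d : nat) (v : seq spoly) : seq spoly :=
  mkseq (fun l => nth [::] ([::] :: v) l
                  ++ spmul (spopp (nth [::] v d.-1)) (coef_in i l p)) d.
Definition xpow (i : nat) (p : spoly) (d n : nat) : seq spoly :=
  iter n (mulx i p d) (mkseq (fun l => if l == 0 then spcst f1 else [::]) d).
(* the entry (r, l) of [h] evaluated at the companion matrix of [p] *)
Definition hrow (i : nat) (p : spoly) (d : nat) (h : spoly) (r l : nat) : spoly :=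
  flatten [seq spmul [:: (strip i t.1, t.2)]
                 (nth [::] (xpow i p d (deg_in i t.1 + r)) l) | t <- h].

(** After [d] rows no column is left, and each state is one signed product of the determinant;
    concatenating sparse polynomials adds them. *)
Definition norm_at (i : nat) (p : spoly) (d : nat) (h : spoly) : spoly :=
  flatten [seq s.1 | s <- nat_primrec [:: (spcst f1, iota 0 d)]
    (fun r st => expand (hrow i p d h r) st) d].

Definition pairs (A B : Type) (s : seq A) (t : seq B) : seq (A * B) :=
  flatten [seq [seq (a, b) | b <- t] | a <- s].

Definition merge_entries (N : nat) (a b : entry) : entry :=
  (spmul a.1 (spexp b.1 N), (vmul a.2.1 (vexp b.2.1 N), a.2.2 ++ b.2.2)).

Section Algorithm.
Variables (S : comNzRingType) (dvd : rel S) (c : seq S).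

Definition is0 (e : intpoly) : bool := ieval c e == 0.
(** Denominators are cleared because [dvd] only compares elements of [S]. *)
Definition fle (x y : fexpr) : bool :=
  dvd (ieval c (IMul x.1 y.2)) (ieval c (IMul y.1 x.2)).
Definition feq (x y : fexpr) : bool := fle x y && fle y x.
(** Both values are brought to the common multiple [w.1 * w'.1] before the comparison. *)
Definition veqb (w w' : value) : bool := feq (fexp w.2 w'.1) (fexp w'.2 w.1).

(* The coefficient of the monomial x_i^n.  A term with denominator 0 has the value
   0, since x / 0 = 0; dropping it makes the denominator of the sum nonzero. *)
Definition pure_coef (i n : nat) (p : spoly) : fexpr :=
  foldr fadd f0 [seq t.2 | t <- coef_in i n p & (t.1 == [::]) && ~~ is0 t.2.2].
(** Terms of the input may vanish or cancel, so the degree is found by zero tests. Terms free of the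
    other variables suffice for a monic polynomial, whose leading coefficient is the constant 1. *)
Definition pdeg (i : nat) (p : spoly) : nat :=
  maxsat (fun n => ~~ is0 (pure_coef i n p).1) (maxlen p).

Definition norm_all (ps : seq (nat * spoly)) (h : spoly) : spoly :=
  foldr (fun ip h => norm_at ip.1 ip.2 (pdeg ip.1 ip.2) h) h ps.
(** [T] is the variable of index [k], which is fresh since root vectors use the indices below [k].
    As [maxlen] is only a bound on the degree, the list may end with zeros. *)
Definition charp (ps : seq (nat * spoly)) (k : nat) (h : spoly) : seq fexpr :=
  mkseq (fun l => pure_coef k l (norm_all ps (spvar k ++ spopp h)))
        (maxlen (norm_all ps (spvar k ++ spopp h))).+1.

(** An element [g] of value [w] need not lie in K, but [g^m] can be taken to be [w.2.2 / w.2.1]. The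
    list therefore holds [(chi_l g^l)^m] instead of [chi_l g^l], which does not change the order of
    the values. *)
Definition weights (cl : seq fexpr) (w : value) : seq fexpr :=
  mkseq (fun l => fmul (fexp (nth f0 cl l) w.1) (fexp (w.2.2, w.2.1) l)) (size cl).
Definition ismin (W : seq fexpr) (x : fexpr) : bool := all (fle x) W.
Definition mult (cl : seq fexpr) (w : value) : nat :=
  (maxsat (fun l => ismin (weights cl w) (nth f0 (weights cl w) l)) (size cl)
   - find (ismin (weights cl w)) (weights cl w))%N.

Definition slope (x y : fexpr) (m : nat) : seq value :=
  if is0 x.1 || is0 y.1 then [::] else [:: (m, fmul (x.2, x.1) y)].
Definition slopes (cl : seq fexpr) : seq value :=
  flatten (mkseq (fun a => flatten (mkseq (fun m =>
    slope (nth f0 cl a) (nth f0 cl (a + m.+1)) m.+1) (size cl))) (size cl)).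
Definition undupv (l : seq value) : seq value :=
  foldr (fun w acc => if has (veqb w) acc then acc else w :: acc) [::] l.

Definition lowest (cl : seq fexpr) : nat := find (fun x => ~~ is0 x.1) cl.
(* q(h), where [cl] lists the coefficients of T^s q(T), q(0) <> 0 *)
Definition cofactor_at0 (cl : seq fexpr) (h : spoly) : spoly :=
  flatten (mkseq (fun l => spmul (spcst (nth f0 cl (lowest cl + l))) (spexp h l))
                 (size cl)).
(** The last entry stands for [h(x) = 0]: it expects the value of [q(0)] and outputs [(1, (1, 0))],
    which encodes infinity. *)
Definition entries (cl : seq fexpr) (h : spoly) : seq entry :=
  [seq (h, (w, [:: w])) | w <- undupv (slopes cl)]
  ++ [:: (cofactor_at0 cl h,
         ((1%N, ((nth f0 cl (lowest cl)).2, (nth f0 cl (lowest cl)).1)),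
          [:: (1%N, (IOne, IZero))]))].

Definition separates (N : nat) (q : (entry * entry) * (entry * entry)) : bool :=
  veqb (merge_entries N q.1.1 q.1.2).2.1 (merge_entries N q.2.1 q.2.2).2.1
  ==> veqb q.1.1.2.1 q.2.1.2.1 && veqb q.1.2.2.1 q.2.2.2.1.
(* each of the pairs of pairs excludes at most one exponent, hence the bound *)
Definition sep_exponent (s t : seq entry) : nat :=
  maxsat (fun N => all (separates N) (pairs (pairs s t) (pairs s t)))
         (size (pairs (pairs s t) (pairs s t))).+1.
Definition combine (s t : seq entry) : seq entry :=
  [seq merge_entries (sep_exponent s t) q.1 q.2 | q <- pairs s t].

Definition joint (ps : seq (nat * spoly)) (k : nat) (hs : seq spoly) : seq entry :=
  foldr (fun h acc => combine (entries (charp ps k h) h) acc)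
        [:: (spcst f1, ((1%N, f1), [::]))] hs.
Definition values (ps : seq (nat * spoly)) (k : nat) (hs : seq spoly) :
    seq (seq value) :=
  flatten [seq nseq (mult (charp ps k e.1) e.2.1) e.2.2 | e <- joint ps k hs].

Definition monomial_of (e : seq nat) : seq nat :=
  flatten (mkseq (fun i => nseq (nth 0%N e i) i) (size e)).
(** A coefficient becomes the indeterminate of its first occurrence in [c]; with repetitions, any
    occurrence has the same value. *)
Definition symbolic (p : seq (seq nat * (S * S))) : spoly :=
  [seq (monomial_of t.1, (IVar (index t.2.1 c), IVar (index t.2.2 c))) | t <- p].

End Algorithm.

Definition solve (S : comNzRingType) (dvd : rel S) (d : tyden S TInput) :
    tyden S TOutput :=
  values dvd (coefficients d)
    (mkseq (fun i => (i, symbolic (coefficients d) (nth [::] d.1 i))) (size d.1))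
    (size d.1)
    (mkseq spvar (size d.1) ++ [seq symbolic (coefficients d) q | q <- d.2]).

(** * Valuations and Newton polygons *)

Section Valuation.
Variables (L : fieldType) (VL : {pred L}).
Hypothesis HV : is_valuation_ring VL.

(* [v(x) <= v(y)]: divisibility in the valuation ring *)
Definition vle (x y : L) := if x == 0 then y == 0 else y / x \in VL.
Definition veq (x y : L) := vle x y && vle y x.

Let V1 : 1 \in VL. Proof. by case: HV => -[]. Qed.
Let VB x y : x \in VL -> y \in VL -> x - y \in VL.
Proof. by case: HV => -[_ VB _] _; apply: VB. Qed.
Let VM x y : x \in VL -> y \in VL -> x * y \in VL.
Proof. by case: HV => -[_ _ VM] _; apply: VM. Qed.
Let VN x : x \in VL -> - x \in VL.
Proof. by move=> Vx; rewrite -sub0r VB // -(subrr 1) VB. Qed.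
Let VX x n : x \in VL -> x ^+ n \in VL.
Proof. by move=> Vx; elim: n => [|n IH]; rewrite ?expr0 ?exprS ?V1 // VM. Qed.

Lemma vlexx x : vle x x.
Proof. by rewrite /vle; case: eqVneq => // nz; rewrite divff. Qed.

Lemma vlex0 x : vle x 0.
Proof.
by rewrite /vle eqxx; case: eqVneq => //= nz; rewrite mul0r -(subrr 1) VB.
Qed.

Lemma vle0x x : vle 0 x = (x == 0).
Proof. by rewrite /vle eqxx. Qed.

Lemma vle_trans y x z : vle x y -> vle y z -> vle x z.
Proof.
rewrite /vle; case: (eqVneq x 0) => [_ /eqP ->|x0]; first by rewrite eqxx.
case: (eqVneq y 0) => [_ _ /eqP -> | y0 Vyx Vzy]; first by rewrite mul0r -(subrr 1) VB.
by have := VM Vzy Vyx; rewrite mulrA divfK.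
Qed.

Lemma vle_total x y : vle x y || vle y x.
Proof.
rewrite /vle; case: (eqVneq x 0) => [-> | x0].
  by case: (eqVneq y 0) => //= y0; rewrite mul0r -(subrr 1) VB.
case: (eqVneq y 0) => [->|y0]; first by rewrite mul0r -(subrr 1) VB.
by case: HV => _ /(_ (y / x))[-> // | ]; rewrite invf_div orbC => ->.
Qed.

Lemma vleNge x y : ~~ vle x y -> vle y x.
Proof. by have := vle_total x y; case: (vle x y). Qed.

Lemma vleN x y : vle x (- y) = vle x y.
Proof.
rewrite /vle oppr_eq0; case: eqP => // _; rewrite mulNr.
by apply/idP/idP => /VN; rewrite ?opprK.
Qed.

Lemma vleD x y z : vle x y -> vle x z -> vle x (y + z).
Proof.
rewrite /vle; case: eqP => [_ /eqP -> /eqP ->|_]; first by rewrite addr0.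
by move=> Vy Vz; rewrite mulrDl -(opprK (z / x)) VB // VN.
Qed.

Lemma vle_pM2l z x y : z != 0 -> vle (z * x) (z * y) = vle x y.
Proof. by move=> z0; rewrite /vle !mulf_eq0 (negPf z0) /= -mulf_div divff // mul1r. Qed.

Lemma vle_pM2r z x y : z != 0 -> vle (x * z) (y * z) = vle x y.
Proof. by move=> z0; rewrite ![_ * z]mulrC vle_pM2l. Qed.

Lemma vleM x y x' y' : vle x y -> vle x' y' -> vle (x * x') (y * y').
Proof.
move=> le le'; have [E|x'0] := eqVneq x' 0.
  by move: le'; rewrite E vle0x => /eqP->; rewrite !mulr0 vlexx.
have [y0|y0] := eqVneq y 0; first by rewrite y0 mul0r vlex0.
by apply: (@vle_trans (y * x')); rewrite ?vle_pM2r ?vle_pM2l.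
Qed.

(** The value group is torsion-free: if [t^(m+1)] and [t^-1] are in [VL], so is [t], their product
    after raising [t^-1] to the power [m]. *)
Lemma vleXn m x y : (0 < m)%N -> vle (x ^+ m) (y ^+ m) = vle x y.
Proof.
case: m => // m _; rewrite /vle !expf_eq0 /=; case: (eqVneq x 0) => // x0.
rewrite -expr_div_n; apply/idP/idP => [Vt|]; last exact: VX.
set t := y / x in Vt *; case: HV => _ /(_ t)[//|Vti].
have [-> | t0] := eqVneq t 0; first by rewrite -(subrr 1) VB.
suff -> : t = t ^+ m.+1 * t^-1 ^+ m by rewrite VM // VX.
by rewrite exprS exprVn mulfK // expf_neq0.
Qed.

Lemma vltD x y z : ~~ vle y x -> ~~ vle z x -> ~~ vle (y + z) x.
Proof.
move=> ly lz; case/orP: (vle_total y z) => le.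
  by apply: contra ly; apply: vle_trans; rewrite vleD ?vlexx.
by apply: contra lz; apply: vle_trans; rewrite vleD ?vlexx.
Qed.

Lemma vle_oppl x y : vle (- x) y = vle x y.
Proof.
rewrite /vle oppr_eq0; case: eqP => // _; rewrite invrN mulrN.
by apply/idP/idP => /VN; rewrite ?opprK.
Qed.

(** Otherwise [y = (y + z) - z] would have a value larger than that of [x]. *)
Lemma vle_dominant x y z : vle y x -> ~~ vle z x -> vle (y + z) x.
Proof.
move=> le; apply: contraLR => lt; rewrite negbK.
have [//|lz] := boolP (vle z x).
have := vltD lt (z := - z); rewrite vle_oppl addrK => /(_ lz); by rewrite le.
Qed.

Lemma vltM x x' y y' : x != 0 -> vle x x' -> ~~ vle y' y -> ~~ vle (x' * y') (x * y).
Proof.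
move=> x0 le; apply: contra => le'; rewrite -(vle_pM2l _ _ x0).
by apply: vle_trans le'; rewrite vleM ?vlexx.
Qed.

Lemma vltMr x x' y y' : y != 0 -> ~~ vle x' x -> vle y y' -> ~~ vle (x' * y') (x * y).
Proof. by move=> y0 lt le; rewrite ![_ * y]mulrC ![_ * y']mulrC vltM. Qed.

Lemma veqxx x : veq x x. Proof. by rewrite /veq vlexx. Qed.

Lemma veq_sym x y : veq x y = veq y x. Proof. exact: andbC. Qed.

Lemma veq_trans y x z : veq x y -> veq y z -> veq x z.
Proof. by move=> /andP[? ?] /andP[? ?]; apply/andP; split; apply: (@vle_trans y). Qed.

Lemma veqM x y x' y' : veq x y -> veq x' y' -> veq (x * x') (y * y').
Proof. by move=> /andP[? ?] /andP[? ?]; apply/andP; split; apply: vleM. Qed.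

Lemma veq_pM2l z x y : z != 0 -> veq (z * x) (z * y) = veq x y.
Proof. by move=> z0; rewrite /veq !vle_pM2l. Qed.

Lemma veqXn m x y : (0 < m)%N -> veq (x ^+ m) (y ^+ m) = veq x y.
Proof. by move=> m0; rewrite /veq !vleXn. Qed.

Lemma veqX m x y : veq x y -> veq (x ^+ m) (y ^+ m).
Proof. by case: m => [|m]; rewrite ?veqxx // veqXn. Qed.

Lemma veq0 x y : veq x y -> (x == 0) = (y == 0).
Proof.
case/andP; rewrite /vle; case: eqP => [_ ->//|/eqP x0].
by case: eqP => // _ _ /eqP /(negP x0).
Qed.

Lemma veql x y z : veq x y -> veq x z = veq y z.
Proof.
move=> xy; apply/idP/idP; apply: veq_trans => //; by rewrite veq_sym.
Qed.

Lemma veqr x y z : veq x y -> veq z x = veq z y.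
Proof. by move=> xy; rewrite ![veq z _]veq_sym; apply: veql. Qed.

(** For [e l = chi_l g^l], [mu] has the least value among the [e l], and [a], [b] are the first and
    last indices reaching it: the ends of the edge of the Newton polygon of [chi] attached to
    [v(g)]. *)
Definition newton_edge (e : nat -> L) (mu : L) (a b : nat) :=
  [/\ mu != 0, forall l, vle mu (e l), vle (e a) mu /\ vle (e b) mu,
      forall l, (l < a)%N -> ~~ vle (e l) mu
    & forall l, (b < l)%N -> ~~ vle (e l) mu].

Lemma newton_edge_eq e e' mu a b :
  e =1 e' -> newton_edge e mu a b -> newton_edge e' mu a b.
Proof.
move=> E [m0 H1 [H2 H2'] H3 H4]; split; rewrite -?E // => l; rewrite -E; auto.
Qed.

Definition shift (e : nat -> L) l := if l is l'.+1 then e l' else 0.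

(** If [e] belongs to [chi], the new sequence belongs to [(X - y) chi]. At each end of the new edge
    only one of the two terms reaches the minimum; cancellation, possible inside the edge when
    [v(y) = v(g)], thus never moves an end. *)
Lemma newton_step e mu a b g y : g != 0 -> newton_edge e mu a b ->
  newton_edge (fun l => g * shift e l - y * e l) (if vle g y then g * mu else y * mu)
     (a + (~~ vle y g)) (b + vle g y).
Proof.
move=> g0 [mu0 Hall [Ha Hb] Hlo Hhi].
have Hsh l : vle mu (shift e l) by case: l => [|l] /=; rewrite ?vlex0.
have Hslo l : (l < a.+1)%N -> ~~ vle (shift e l) mu.
  case: l => [|l] /=; last exact: Hlo.
  by rewrite vle0x (negPf mu0).
have [gy|gy] := ifPn.
  have mu'0 : g * mu != 0 by rewrite mulf_neq0.
  split=> //.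
  - by move=> l; rewrite vleD ?vleN ?vleM ?vlexx.
  - have Hb' : vle (g * shift e (b + 1)%N - y * e (b + 1)%N) (g * mu).
      rewrite ?addn1 /= vle_dominant ?vle_oppl ?vle_pM2l //.
      by rewrite vltM ?Hhi ?addn1.
    (* If [v(y) = v(g)], the term [y * e a] keeps the left end at [a]; otherwise only the shifted
       sequence is minimal and the left end moves too. *)
    split=> //; have [yg|yg] := boolP (vle y g).
      rewrite addn0 addrC vle_dominant ?vle_oppl //.
        by rewrite vleM.
      by rewrite vle_pM2l // Hslo.
    rewrite addn1 /= vle_dominant ?vle_oppl ?vle_pM2l //.
    by rewrite vltMr.
  - move=> l; have [yg|yg] /= := boolP (vle y g) => Hl.
      rewrite vltD ?vle_oppl ?vle_pM2l ?Hslo //; first by lia.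
      by rewrite vltM // Hlo //; lia.
    rewrite vltD ?vle_oppl ?vle_pM2l ?Hslo //; first by lia.
    by rewrite vltMr.
  move=> l Hl; have [l' El] : exists l', l = l'.+1 by exists l.-1; lia.
  rewrite El /= vltD ?vle_oppl ?vle_pM2l ?Hhi //; first by lia.
  by rewrite vltM // Hhi //; lia.
have yg := vleNge gy.
have y0 : y != 0 by apply: contraNneq gy => ->; rewrite vlex0.
have mu'0 : y * mu != 0 by rewrite mulf_neq0.
rewrite yg /= !addn0; split=> //.
- by move=> l; rewrite vleD ?vleN ?vleM ?vlexx.
- by split; rewrite addrC vle_dominant ?vle_oppl ?vle_pM2l // vltMr.
- move=> l Hl; rewrite vltD ?vle_oppl ?vle_pM2l ?Hlo //.
  by rewrite vltMr.
move=> l Hl; rewrite vltD ?vle_oppl ?vle_pM2l ?Hhi //.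
by rewrite vltMr.
Qed.

(** The roots are multiplied in one by one: a root of value above [v(g)] moves both ends of the
    edge, one of value [v(g)] only the right end, a smaller one neither. *)
Lemma newton_prod ys g : g != 0 ->
  exists mu, newton_edge (fun l => (\prod_(y <- ys) ('X - y%:P))`_l * g ^+ l) mu
    (count (fun y => ~~ vle y g) ys) (count (vle g) ys).
Proof.
move=> g0; elim: ys => [|y ys [mu IH]] /=.
  exists 1; split; rewrite ?oner_neq0 //.
  - by move=> [|l]; rewrite big_nil coef1 /= ?mul1r ?mul0r ?vlex0 ?vlexx.
  - by rewrite big_nil coef1 expr0 mul1r vlexx.
  by move=> [|l] //; rewrite big_nil coef1 mul0r vle0x oner_eq0.
eexists; rewrite [(~~ _ + _)%N]addnC [(vle _ _ + _)%N]addnC.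
apply: newton_edge_eq (newton_step y g0 IH) => l; rewrite big_cons.
rewrite mulrBl coefB coefXM coefCM; case: l => [|l] /=; first by ring.
by rewrite exprS; ring.
Qed.

Lemma count_veq g ys :
  (count (vle g) ys - count (fun y => ~~ vle y g) ys)%N = count (veq g) ys.
Proof.
have E (y : L) : (vle g y = veq g y + ~~ vle y g :> nat)%N.
  by rewrite /veq; have := vle_total g y; case: (vle g y); case: (vle y g).
suff -> : count (vle g) ys = (count (veq g) ys + count (fun y => ~~ vle y g) ys)%N.
  by rewrite addnK.
by elim: ys => //= y ys ->; rewrite E; lia.
Qed.

End Valuation.

(** * Norms as determinants *)

Section Companion.
Variable L : closedFieldType.

(* coordinates of [X^n] modulo a monic polynomial of degree [d] *)
Fixpoint xvec (p : nat -> L) (d n l : nat) : L :=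
  if n is n'.+1 then
    (if l is l'.+1 then xvec p d n' l' else 0) - xvec p d n' d.-1 * p l
  else (l == 0)%:R.

Lemma xvec_small p d n l : (n < d)%N -> xvec p d n l = (n == l)%:R.
Proof.
elim: n l => [|n IH] l lt /=; first by rewrite eq_sym.
rewrite (IH d.-1) ?(ltnW lt) // (_ : (n == d.-1) = false) ?mul0r ?subr0; last by lia.
by case: l => [|l] //; rewrite IH ?eqSS // ltnW.
Qed.

(** [companionmx] has dimension [(size p).-1]; with a visible successor the matrices form a ring. *)
Lemma companion_exists (p : {poly L}) d : p \is monic -> size p = d.+2 ->
  exists2 C : 'M[L]_d.+1, char_poly C = p
    & forall i j, C i j = if i == d :> nat then - p`_j else (i.+1 == j :> nat)%:R.
Proof.
move=> mon sz; have := companionmxK mon; rewrite /companionmx.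
rewrite sz /= => H; eexists; first exact: H.
by move=> i j; rewrite mxE.
Qed.

(** A linear factor [X - b] of [h] contributes [det (C - b)], which is up to sign the characteristic
    polynomial at [b], hence the product of the [a - b]. It remains to exchange the products over
    the roots of [h] and over [rs]. *)
Lemma det_horner_closed n (C : 'M[L]_n.+1) (rs : seq L) (h : {poly L}) :
  char_poly C = \prod_(a <- rs) ('X - a%:P) ->
  \det (horner_mx C h) = \prod_(a <- rs) h.[a].
Proof.
move=> EC; have [bs Eh] := closed_field_poly_normal h.
have szrs : size rs = n.+1.
  by have := size_char_poly C; rewrite EC size_prod_XsubC => -[].
have detB b : \det (C - b%:M) = \prod_(a <- rs) (a - b).
  have -> : C - b%:M = -1 *: (b%:M - C) by rewrite scaleN1r opprB.
  rewrite detZ; have -> : \det (b%:M - C) = (char_poly C).[b].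
    rewrite /char_poly -[RHS]/(horner_eval b _) -det_map_mx; congr (\det _).
    apply/matrixP => i j; rewrite !mxE /= /horner_eval !hornerE.
    by rewrite hornerMn hornerX.
  rewrite EC horner_prod -szrs; elim: (rs) => [|a s IH] /=.
    by rewrite !big_nil expr0 mulr1.
  by rewrite !big_cons -IH exprS hornerXsubC; ring.
rewrite {1}Eh linearZ /= detZ rmorph_prod /=.
rewrite (eq_bigr (fun a => lead_coef h * \prod_(b <- bs) (a - b))); last first.
  by move=> a _; rewrite {1}Eh hornerZ horner_prod; congr (_ * _); apply: eq_bigr => b _; rewrite hornerXsubC.
rewrite big_split /= big_const_seq count_predT szrs -Monoid.iteropE; congr (_ * _).
rewrite exchange_big /=; elim: bs {Eh} => [|b bs IH]; first by rewrite !big_nil det1.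
rewrite !big_cons det_mulmx IH; congr (_ * _); rewrite -detB.
by rewrite rmorphB /= horner_mx_X horner_mx_C.
Qed.

(** The matrix is [h(C)] for the companion matrix [C]: its row [r] holds the coordinates of [h X^r]
    modulo the product of the [X - a]. *)
Lemma det_norm (T : Type) (ts : seq T) (c : T -> L) (e : T -> nat)
    (rs : seq L) (p : nat -> L) (d := size rs) :
  (forall l, (l < d)%N -> p l = (\prod_(a <- rs) ('X - a%:P))`_l) ->
  \det (\matrix_(r < d, l < d) \sum_(t <- ts) c t * xvec p d (e t + r) l)
  = \prod_(a <- rs) \sum_(t <- ts) c t * a ^+ e t.
Proof.
(* In degree 0 the matrix is empty and both sides are 1; [horner_mx] needs a positive dimension. *)
rewrite /d; case: rs @d => [|a0 rs0] d Ep; first by rewrite det_mx00 big_nil.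
move: Ep; rewrite /d {d}; set rs := a0 :: rs0 => Ep.
set q := \prod_(a <- rs) _ in Ep.
have [C EC CE] : exists2 C : 'M[L]_((size rs0).+1), char_poly C = q
    & forall i j, C i j = if i == size rs0 :> nat then - q`_j else (i.+1 == j :> nat)%:R.
  apply: companion_exists; first exact: monic_prod_XsubC.
  by rewrite size_prod_XsubC.
pose d := size rs0.
(* Multiplying a row by [C] on the right is multiplication by [X] modulo [q]. *)
have row0 n l : (C ^+ n) ord0 l = xvec p d.+1 n l.
  elim: n l => [|n IH] l; first by rewrite expr0 mxE eq_sym -val_eqE.
  rewrite exprSr mxE big_ord_recr /= IH CE eqxx /= mulrN; congr (_ - _ * _).
    under eq_bigr => i _ do rewrite IH CE /= (ltn_eqF (ltn_ord i)).
    case: l => -[|l] lt /=; first by rewrite big1 // => i _; rewrite mulr0.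
    rewrite (bigD1 (Ordinal (lt : l < d)%N)) //= eqxx mulr1 big1 ?addr0 // => i ne.
    by rewrite eqSS -[_ == _ :> nat]/(i == Ordinal (lt : l < d)%N) (negPf ne) mulr0.
  by rewrite Ep.
(* The first row of [C^r] is the unit vector of index [r], so row [r] of [C^n] is the first row of
   [C^(n+r)]. *)
have rowr n (r l : 'I_d.+1) : (C ^+ n) r l = xvec p d.+1 (n + r) l.
  rewrite -row0 addnC exprD mxE (bigD1 r) //= row0 xvec_small // eqxx mul1r.
  rewrite big1 ?addr0 // => i ne; rewrite row0 xvec_small //.
  by rewrite eq_sym -[_ == _ :> nat]/(i == r) (negPf ne) mul0r.
pose h := \sum_(t <- ts) c t *: 'X^(e t).
transitivity (\det (horner_mx C h)).
  congr (\det _); apply/matrixP => r l; rewrite !mxE /h rmorph_sum summxE.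
  apply: eq_bigr => t _.
  have E : horner_mx C (c t *: 'X^(e t)) = c t *: C ^+ e t.
    by rewrite -mul_polyC rmorphM /= horner_mx_C rmorphXn /= horner_mx_X; exact: mul_scalar_mx.
  by have := congr1 (fun M : 'M_ _ => M r l) E; rewrite mxE rowr => <-.
rewrite (det_horner_closed _ EC); apply: eq_bigr => a _.
by rewrite horner_sum; apply: eq_bigr => t _; rewrite hornerZ hornerXn.
Qed.

End Companion.

(** * Evaluation of symbolic polynomials *)

Section Laplace.
Variables (R : comNzRingType) (sg : intpoly -> R).
Hypotheses (sg1 : sg IOne = 1) (sgN : forall e, sg (IOpp e) = - sg e).

(** [F] is arbitrary so that the induction can negate the sign and put [x] back among the remaining
    columns. *)
Lemma sum_picks (J : seq nat) (F : R -> nat -> seq nat -> R) :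
  \sum_(q <- picks J) F (sg q.1) q.2.1 q.2.2
  = \sum_(a < size J) F ((-1) ^+ a) (nth 0%N J a) (take a J ++ drop a.+1 J).
Proof.
elim: J F => [|x J IH] F /=; first by rewrite big_nil big_ord0.
rewrite big_cons big_ord_recl /= expr0 sg1 drop0; congr (_ + _).
rewrite big_map /=; under eq_bigr => q _ do rewrite sgN.
rewrite (IH (fun s y K => F (- s) y (x :: K))).
by apply: eq_bigr => a _; rewrite exprS mulN1r.
Qed.

Definition minor (M : nat -> nat -> R) (r : nat) (J : seq nat) : R :=
  \det (\matrix_(i < size J, l < size J) M (r + i)%N (nth 0%N J l)).

Lemma minor_nil M r : minor M r [::] = 1.
Proof. exact: det_mx00. Qed.

Lemma minor_expand M r J : (0 < size J)%N ->
  minor M r J =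
  \sum_(q <- picks J) sg q.1 * M r q.2.1 * minor M r.+1 q.2.2.
Proof.
case: J => // x J _; rewrite (sum_picks _ (fun s y K => s * M r y * minor M r.+1 K)).
rewrite /minor; set J' := x :: J.
rewrite (expand_det_row _ ord0); apply: eq_bigr => a _.
rewrite mxE addn0 /cofactor add0n mulrCA mulrA; congr (_ * _).
have aJ : (a < size J')%N by case: a.
have sz : size (take a J' ++ drop a.+1 J') = size J.
  by rewrite size_cat size_take size_drop aJ; move: aJ; rewrite /J' /=; lia.
rewrite /minor sz; congr (\det _); apply/matrixP => i l; rewrite !mxE /=.
(* [lift] skips row 0 and column [a]; the latter is the gap between [take a] and [drop a.+1]. *)
congr (M _ _); first by rewrite /bump /= add1n addnS addSn.
rewrite nth_cat size_takel; last exact: ltnW.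
rewrite /bump.
case: (ltnP l a) => la; first by rewrite nth_take // add0n.
by rewrite add1n (nth_drop a.+1 0%N J') addSn subnKC.
Qed.

End Laplace.

Section Evaluation.
Variables (S : comNzRingType) (L : closedFieldType) (j : {rmorphism S -> L}).
Variable c : seq S.

Definition cv (e : intpoly) : L := j (ieval c e).
Definition fv (x : fexpr) : L := cv x.1 / cv x.2.
Definition ev (env : nat -> L) (p : spoly) : L :=
  \sum_(t <- p) fv t.2 * \prod_(i <- t.1) env i.
Definition upd (env : nat -> L) (i : nat) (a : L) : nat -> L :=
  fun l => if l == i then a else env l.

Lemma cv1 : cv IOne = 1. Proof. exact: rmorph1. Qed.
Lemma cv0 : cv IZero = 0. Proof. exact: rmorph0. Qed.
Lemma cvN e : cv (IOpp e) = - cv e. Proof. exact: rmorphN. Qed.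
Lemma cvM e e' : cv (IMul e e') = cv e * cv e'. Proof. exact: rmorphM. Qed.
Lemma cvD e e' : cv (IAdd e e') = cv e + cv e'. Proof. exact: rmorphD. Qed.

Lemma fv1 : fv f1 = 1. Proof. by rewrite /fv cv1 divr1. Qed.
Lemma fv0 : fv f0 = 0. Proof. by rewrite /fv cv0 mul0r. Qed.
Lemma fv_cst e : fv (e, IOne) = cv e. Proof. by rewrite /fv cv1 divr1. Qed.
Lemma fvM x y : fv (fmul x y) = fv x * fv y.
Proof. by rewrite /fv !cvM invfM mulrACA. Qed.
Lemma fvX x n : fv (fexp x n) = fv x ^+ n.
Proof. by elim: n => [|n IH]; rewrite ?fv1 //= fvM IH -exprS. Qed.

Lemma fvD x y : cv x.2 != 0 -> cv y.2 != 0 -> fv (fadd x y) = fv x + fv y.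
Proof. by move=> x0 y0; rewrite /fv addf_div // -!cvM -cvD. Qed.

Lemma ev_nil env : ev env [::] = 0. Proof. exact: big_nil. Qed.
Lemma ev_cat env p q : ev env (p ++ q) = ev env p + ev env q.
Proof. exact: big_cat. Qed.
Lemma ev_flatten env ps : ev env (flatten ps) = \sum_(p <- ps) ev env p.
Proof. by elim: ps => [|p ps IH] /=; rewrite ?big_nil ?ev_nil // big_cons ev_cat IH. Qed.
Lemma ev_cst env x : ev env (spcst x) = fv x.
Proof. by rewrite /ev big_seq1 big_nil mulr1. Qed.
Lemma ev_var env i : ev env (spvar i) = env i.
Proof. by rewrite /ev !big_seq1 fv1 mul1r. Qed.
Lemma ev_mul env p q : ev env (spmul p q) = ev env p * ev env q.
Proof.
rewrite ev_flatten big_map [ev env p]/ev big_distrl; apply: eq_bigr => t _ /=.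
rewrite /ev big_map big_distrr; apply: eq_bigr => u _ /=.
by rewrite fvM big_cat /= mulrACA.
Qed.
Lemma ev_opp env p : ev env (spopp p) = - ev env p.
Proof. by rewrite ev_mul ev_cst fv_cst cvN cv1 mulN1r. Qed.
Lemma ev_exp env p n : ev env (spexp p n) = ev env p ^+ n.
Proof. by elim: n => [|n IH]; rewrite ?ev_cst ?fv1 //= ev_mul IH -exprS. Qed.
Lemma eq_ev env env' p : env =1 env' -> ev env p = ev env' p.
Proof. by move=> E; apply: eq_bigr => t _; congr (_ * _); apply: eq_bigr. Qed.

Lemma ev_upd env i a p : ev (upd env i a) p =
  \sum_(t <- p) fv t.2 * (\prod_(l <- strip i t.1) env l) * a ^+ deg_in i t.1.
Proof.
apply: eq_bigr => t _; rewrite -mulrA; congr (_ * _).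
elim: t.1 => [|l m IH] /=; first by rewrite !big_nil expr0 mulr1.
rewrite big_cons {}IH /upd; case: eqP => [->|] /=.
  by rewrite exprS mulrCA.
by rewrite big_cons -mulrA.
Qed.

Lemma ev_coef_in env i n p : ev env (coef_in i n p) =
  \sum_(t <- p | deg_in i t.1 == n) fv t.2 * \prod_(l <- strip i t.1) env l.
Proof. by rewrite /ev big_map big_filter. Qed.

Lemma ev_xpow env i p d n l : (l < d)%N ->
  ev env (nth [::] (xpow i p d n) l)
  = xvec (fun l => ev env (coef_in i l p)) d n l.
Proof.
elim: n l => [|n IH] l ld /=.
  by rewrite nth_mkseq //; case: eqP => _; rewrite ?ev_cst ?fv1 ?ev_nil.
rewrite nth_mkseq // ev_cat ev_mul ev_opp IH ?mulNr; last by lia.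
by case: l ld => [|l] ld /=; rewrite ?ev_nil // IH // ltnW.
Qed.

Lemma ev_hrow env i p d h r l : (l < d)%N ->
  ev env (hrow i p d h r l) =
  \sum_(t <- h) fv t.2 * (\prod_(l <- strip i t.1) env l)
               * xvec (fun l => ev env (coef_in i l p)) d (deg_in i t.1 + r) l.
Proof.
move=> ld; rewrite ev_flatten big_map; apply: eq_bigr => t _.
by rewrite ev_mul ev_xpow // /ev big_seq1.
Qed.

Lemma eq_big_all (T : Type) (P : pred T) (s : seq T) (F G : T -> L) :
  all P s -> (forall x, P x -> F x = G x) ->
  \sum_(x <- s) F x = \sum_(x <- s) G x.
Proof.
move=> all_s E; elim: s all_s => [|x s IH] /=; first by rewrite !big_nil.
by case/andP => Px /IH IHs; rewrite !big_cons IHs E.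
Qed.

Lemma all_flatten (T : Type) (P : pred T) (ss : seq (seq T)) :
  all P (flatten ss) = all (all P) ss.
Proof. by elim: ss => //= s ss IH; rewrite all_cat IH. Qed.

Lemma has_flatten (T : Type) (P : pred T) (ss : seq (seq T)) :
  has P (flatten ss) = has (has P) ss.
Proof. by elim: ss => //= s ss IH; rewrite has_cat IH. Qed.

Lemma size_picks K : all (fun q => size q.2.2 == (size K).-1) (picks K).
Proof.
elim: K => // x [|y K] // IH.
have -> : picks (x :: y :: K) = (IOne, (x, y :: K)) ::
  [seq (IOpp q.1, (q.2.1, x :: q.2.2)) | q <- picks (y :: K)] by [].
by rewrite /all -/(all _) eqxx all_map.
Qed.

(** Invariant of the Laplace expansion: each state holds a signed product from the first [n] rows,
    and is weighted by the minor of the rows and columns still to be used. *)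
Lemma ev_expand env (row : nat -> nat -> spoly) (J : seq nat) n :
  let st := nat_primrec [:: (spcst f1, J)] (fun r st => expand (row r) st) n in
  (n <= size J)%N ->
  all (fun s => size s.2 == size J - n)%N st /\
  minor (fun r l => ev env (row r l)) 0 J
  = \sum_(s <- st) ev env s.1 * minor (fun r l => ev env (row r l)) n s.2.
Proof.
elim: n => [|n IH] /= nJ.
  by rewrite subn0 eqxx big_seq1 ev_cst fv1 mul1r.
have [IH1 ->] := IH (ltnW nJ); split.
  rewrite all_flatten all_map; apply: sub_all IH1 => s /eqP sz /=.
  rewrite all_map; apply: sub_all (size_picks s.2) => q /= /eqP ->.
  by rewrite sz; apply/eqP; lia.
rewrite big_flatten big_map; apply: (eq_big_all IH1) => s /eqP sz.
rewrite big_map /= (minor_expand (sg := cv)) ?cv1 //; [|exact: cvN|by lia].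
rewrite big_distrr; apply: eq_bigr => q _.
by rewrite /= !ev_mul ev_cst fv_cst; ring.
Qed.

(** This is [det_norm] for [h] as a polynomial in [X_i], its other variables being evaluated in
    [env]; the minors left at the end of the expansion are empty, hence 1. *)
Lemma ev_norm_at env i p rs h :
  (forall l, (l < size rs)%N ->
     ev env (coef_in i l p) = (\prod_(a <- rs) ('X - a%:P))`_l) ->
  ev env (norm_at i p (size rs) h) = \prod_(a <- rs) ev (upd env i a) h.
Proof.
move=> Ep; have [] := ev_expand env (hrow i p (size rs) h) (J := iota 0 (size rs)) (n := size rs).
  by rewrite size_iota.
rewrite size_iota subnn => H1 H2.
under eq_bigr do rewrite ev_upd.
rewrite -(det_norm h (fun t => fv t.2 * (\prod_(l <- strip i t.1) env l))
           (fun t => deg_in i t.1) Ep).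
transitivity (minor (fun r l => ev env (hrow i p (size rs) h r l)) 0 (iota 0 (size rs))).
  rewrite H2 ev_flatten big_map; apply: (eq_big_all H1) => s /nilP ->.
  by rewrite minor_nil mulr1.
rewrite /minor size_iota; congr (\det _); apply/matrixP => r l; rewrite !mxE.
by rewrite nth_iota // !add0n ev_hrow.
Qed.

End Evaluation.

(** * Characteristic polynomials over the root vectors *)

Lemma maxsatS (P : pred nat) B :
  maxsat P B.+1 = if P B.+1 then B.+1 else maxsat P B.
Proof. by []. Qed.

Lemma maxsat_eq (P : pred nat) B d : (d <= B)%N -> ((0 < d)%N -> P d) ->
  (forall n, (d < n <= B)%N -> ~~ P n) -> maxsat P B = d.
Proof.
elim: B => [|B IH] dB Pd Pn; first by case: d dB {Pd Pn}.
rewrite maxsatS; have [E|ne] := eqVneq d B.+1; first by rewrite -E Pd // E.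
rewrite (negPf (Pn B.+1 _)) ?leqnn ?andbT; last by lia.
by apply: IH => // [|n /andP[lt le]]; [|apply: Pn]; lia.
Qed.

Lemma maxsat_sat (P : pred nat) B : (exists2 n, (0 < n <= B)%N & P n) ->
  (0 < maxsat P B)%N /\ P (maxsat P B).
Proof.
elim: B => [|B IH] [n le Pn]; first by lia.
rewrite maxsatS.
case: ifP => // PB; apply: IH; exists n => //.
by have : n != B.+1; [apply: contraFneq PB => <-|lia].
Qed.

(** If the difference [r] vanishes everywhere, [r + 1] has no root; over a closed field it is
    constant, and so is [r]. *)
Lemma poly_eq_closed (L : closedFieldType) (p q : {poly L}) :
  (forall x, p.[x] = q.[x]) -> p = q.
Proof.
move=> E; apply/eqP; rewrite -subr_eq0; set r := p - q.
have r0 x : r.[x] = 0 by rewrite hornerD hornerN E subrr.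
have [sz|/closed_rootP [x]] := eqVneq (size (r + 1)) 1.
  have Er : r = (r`_0)%:P.
    apply: size1_polyC; rewrite -(addrK 1 r) (leq_trans (size_polyD _ _)) //.
    by rewrite sz size_polyN size_poly1.
  by rewrite Er -horner_coef0 r0.
by rewrite /root hornerD r0 add0r hornerC oner_eq0.
Qed.

Section CharPoly.
Variables (S : comNzRingType) (L : closedFieldType) (j : {rmorphism S -> L}).
Hypothesis inj_j : injective j.
Variable c : seq S.
Local Notation cv := (cv j c).
Local Notation fv := (fv j c).
Local Notation ev := (ev j c).

Lemma is0E e : is0 c e = (cv e == 0).
Proof. by rewrite /is0 -(rmorph0 j) (inj_eq inj_j). Qed.

Lemma fv_eq0 x : cv x.2 != 0 -> (fv x == 0) = is0 c x.1.
Proof. by move=> x0; rewrite is0E /fv mulf_eq0 invr_eq0 (negPf x0) orbF. Qed.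

Lemma pure_coefP i n p : cv (pure_coef c i n p).2 != 0 /\
  fv (pure_coef c i n p) = ev (fun=> 0) (coef_in i n p).
Proof.
rewrite /pure_coef; elim: (coef_in i n p) => [|[m x] q [IH1 IH2]] /=.
  by rewrite cv1 oner_neq0 fv0 ev_nil.
rewrite [ev _ _]big_cons /= -/(ev _ q) -IH2 is0E.
case: m => [|l m] /=; last by rewrite big_cons mul0r mulr0 add0r.
rewrite big_nil mulr1; have [x0|x0] := eqVneq (cv x.2) 0.
  by rewrite {2}/fv x0 invr0 mulr0 add0r.
by rewrite fvD // cvM mulf_neq0.
Qed.

Lemma deg_in_le i p : all (fun t => deg_in i t.1 <= maxlen p)%N p.
Proof.
elim: p => // t p IH; have E : maxlen (t :: p) = (size t.1 + maxlen p)%N.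
  by rewrite /maxlen /= size_cat.
have le : (deg_in i t.1 <= size t.1)%N := count_size _ _.
apply/andP; split; first by rewrite E; lia.
by apply: sub_all IH => u; rewrite E; lia.
Qed.

Lemma coef_in_nil i n p : (maxlen p < n)%N -> coef_in i n p = [::].
Proof.
move=> lt; have := deg_in_le i p; rewrite /coef_in.
elim: {2 3}p => //= t q IH /andP[le /IH E].
by case: eqP => // E'; lia.
Qed.

Lemma pdegE i p (q : {poly L}) : q \is monic ->
  (forall n, ev (fun=> 0) (coef_in i n p) = q`_n) ->
  pdeg c i p = (size q).-1.
Proof.
move=> mon E; have F n : is0 c (pure_coef c i n p).1 = (q`_n == 0).
  by have [? H] := pure_coefP i n p; rewrite -E -H fv_eq0.
have lead : q`_(size q).-1 = 1 by apply/eqP.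
apply: maxsat_eq.
- rewrite leqNgt; apply/negP => /(coef_in_nil i) H.
  by have := E (size q).-1; rewrite H ev_nil lead => /eqP; rewrite eq_sym oner_eq0.
- by rewrite F lead oner_eq0.
by move=> n /andP[lt _]; rewrite F negbK nth_default //; move: lt; case: (size q).
Qed.

Definition at_pt (x : seq L) (h : spoly) : L := ev (fun l => x`_l) h.
Definition pt (k : nat) (T : L) (x : seq L) : nat -> L := upd (fun l => x`_l) k T.

(** Giving the variable [k] the value [T] must not change [h(x)]. Stated through evaluation, this
    needs no syntactic invariant on monomial lists. *)
Definition below (k : nat) (h : spoly) := forall env env' : nat -> L,
  (forall l, (l < k)%N -> env l = env' l) -> ev env h = ev env' h.

Lemma below_cst k x : below k (spcst x).
Proof. by move=> env env' _; rewrite !ev_cst. Qed.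
Lemma below_var k i : (i < k)%N -> below k (spvar i).
Proof. by move=> ik env env' E; rewrite !ev_var E. Qed.
Lemma below_mul k p q : below k p -> below k q -> below k (spmul p q).
Proof. by move=> Bp Bq env env' E; rewrite !ev_mul (Bp _ _ E) (Bq _ _ E). Qed.
Lemma below_exp k p n : below k p -> below k (spexp p n).
Proof. by move=> Bp env env' E; rewrite !ev_exp (Bp _ _ E). Qed.
Lemma below_flatten k (A : Type) (f : A -> spoly) s :
  (forall a, below k (f a)) -> below k (flatten [seq f a | a <- s]).
Proof.
move=> B env env' E; rewrite !ev_flatten !big_map; apply: eq_bigr => a _.
exact: B.
Qed.

Variables (k : nat) (sp : 'I_k -> seq L -> {poly L}) (ps : 'I_k -> spoly).
Variable d : 'I_k -> nat.
Hypothesis sp_monic : forall i x, sp i x \is monic.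
Hypothesis sp_size : forall i x, size (sp i x) = (d i).+1.
Hypothesis psE : forall (i : 'I_k) x env, (forall l, (l < i)%N -> env l = x`_l) ->
  forall n, ev env (coef_in i n (ps i)) = (sp i x)`_n.

Definition extend (R : seq (seq L)) (i : 'I_k) :=
  [seq rcons x a | x <- R, a <- roots_of (sp i x)].

Lemma sp_roots i x : sp i x = \prod_(a <- roots_of (sp i x)) ('X - a%:P).
Proof.
rewrite /roots_of; case: closed_field_poly_normal => rs /= {1}->.
by rewrite (eqP (sp_monic i x)) scale1r.
Qed.

Lemma size_roots i x : size (roots_of (sp i x)) = d i.
Proof. by have := sp_size i x; rewrite {1}sp_roots size_prod_XsubC => -[]. Qed.

Lemma size_extend R s :
  size (foldl extend R s) = (size R * \prod_(i <- s) d i)%N.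
Proof.
elim: s R => [|i s IH] R /=; first by rewrite big_nil muln1.
rewrite IH big_cons mulnA; congr muln.
rewrite size_allpairs_dep; elim: R => //= x R ->; rewrite size_roots; lia.
Qed.

Lemma extend_all R (i : 'I_k) n : all (fun x => size x == n) R ->
  all (fun x => size x == n.+1) (extend R i).
Proof.
move=> /allP sz; apply/allP => y /allpairsPdep [x [a [/sz /eqP <- _ ->]]].
by rewrite size_rcons.
Qed.

Lemma foldl_extend_all R (s : seq 'I_k) n : all (fun x => size x == n) R ->
  all (fun x => size x == n + size s)%N (foldl extend R s).
Proof.
elim: s R n => [|i s IH] R n szR /=; first by rewrite addn0.
by rewrite addnS -addSn IH // extend_all.
Qed.

(** Stated for a final segment [s] of the system and partial root vectors of length [n]: the
    variable that [foldl] adds last is the one that [foldr] eliminates first. *)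
Lemma ev_norm_all (T : L) h (s : seq 'I_k) n R :
  [seq val i | i <- s] = iota n (size s) -> all (fun x => size x == n) R ->
  \prod_(x <- foldl extend R s) ev (pt k T x) h
  = \prod_(x <- R) ev (pt k T x) (norm_all c [seq (val i, ps i) | i <- s] h).
Proof.
elim: s n R => [|i s IH] n R //= [Ei Es] szR.
rewrite (IH n.+1) //; last exact: extend_all.
rewrite big_allpairs_dep /=; apply: eq_big_seq => x /(allP szR) /eqP szx.
have pdi : pdeg c i (ps i) = size (roots_of (sp i x)).
  (* The degree is the same at all points; [[::]] acts as the zero vector, by the default value of
     [nth]. *)
  rewrite (@pdegE _ _ (sp i [::])) // ?sp_size ?size_roots // => m.
  by apply: psE => l _; rewrite nth_nil.
have neq : (val i == k) = false by apply: ltn_eqF; exact: ltn_ord.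
rewrite pdi ev_norm_at; last first.
  move=> l _; rewrite -sp_roots; apply: psE => m mi.
  by rewrite /pt /upd ltn_eqF // (ltn_trans mi) ?ltn_ord.
apply: eq_bigr => a _; apply: eq_ev => l.
rewrite /pt /upd nth_rcons szx -Ei; case: (eqVneq l k) => [->|_].
  by rewrite eq_sym neq.
by case: ltngtP => // lt; rewrite nth_default // szx -Ei ltnW.
Qed.

Definition system := [seq (val i, ps i) | i <- enum 'I_k].
Definition points := foldl extend [:: [::]] (enum 'I_k).

Lemma points_size x : x \in points -> size x = k.
Proof.
have := @foldl_extend_all [:: [::]] (enum 'I_k) 0%N isT.
by rewrite size_enum_ord => /allP H /H /eqP.
Qed.

Lemma charp_den h l : cv (nth f0 (charp c system k h) l).2 != 0.
Proof.
have [lt|ge] := ltnP l (size (charp c system k h)).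
  by move: lt; rewrite size_mkseq => lt; rewrite nth_mkseq //; case: (pure_coefP k l (norm_all c system (spvar k ++ spopp h))).
by rewrite nth_default // cv1 oner_neq0.
Qed.

(** Elimination is only known through evaluation, so the two polynomials are compared at every [T],
    where [ev_norm_all] applies to [T - h]. *)
Lemma charpE h : below k h ->
  \poly_(l < size (charp c system k h)) fv (nth f0 (charp c system k h) l)
  = \prod_(x <- points) ('X - (at_pt x h)%:P).
Proof.
move=> Bh; apply: poly_eq_closed => T; rewrite horner_prod.
set ch := norm_all c system (spvar k ++ spopp h).
transitivity (ev (pt k T [::]) ch).
  rewrite /pt ev_upd size_mkseq horner_poly.
  under eq_bigr => l _ do
    rewrite nth_mkseq // (proj2 (pure_coefP _ _ _)) ev_coef_in big_distrl.
  rewrite (exchange_big_dep xpredT) //=; apply: (eq_big_all (deg_in_le k ch)) => t le.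
  (* The term [t] contributes to one coefficient only, that of index [deg_in k t.1]. *)
  rewrite (bigD1 (Ordinal (le : (deg_in k t.1 < (maxlen ch).+1)%N))) //= [X in _ + X]big1 ?addr0.
    by congr (_ * _ * _); apply: eq_bigr => l _; rewrite nth_nil.
  by move=> i /andP[/eqP E /eqP []]; apply: val_inj.
have := @ev_norm_all T (spvar k ++ spopp h) (enum 'I_k) 0 [:: [::]].
rewrite big_seq1 => <- //; last by rewrite val_enum_ord size_enum_ord.
apply: eq_big_seq => x /points_size szx; rewrite hornerXsubC ev_cat ev_var ev_opp.
rewrite {1}/pt /upd eqxx; congr (_ - _); apply: Bh => l lk.
by rewrite /pt /upd ltn_eqF.
Qed.

End CharPoly.

(** * Symbolic values *)

Section Values.
Variables (S : comNzRingType) (L : closedFieldType) (j : {rmorphism S -> L}).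
Hypothesis inj_j : injective j.
Variables (VL : {pred L}) (dvd : rel S) (c : seq S).
Hypothesis HV : is_valuation_ring VL.
Hypothesis dvdE : forall a b, dvd a b = vle VL (j a) (j b).
Local Notation cv := (cv j c).
Local Notation fv := (fv j c).
Local Notation vle := (vle VL).
Local Notation veq := (veq VL).

Lemma fleE x y : cv x.2 != 0 -> cv y.2 != 0 -> fle dvd c x y = vle (fv x) (fv y).
Proof.
move=> x0 y0; rewrite /fle dvdE -!/(cv _) !cvM.
rewrite -(vle_pM2r VL (fv x) (fv y) (mulf_neq0 x0 y0)) /fv.
by congr (vle _ _); field; rewrite ?x0 ?y0.
Qed.

Lemma cv_fexp1 x n : cv (fexp x n).1 = cv x.1 ^+ n.
Proof. by elim: n => [|n IH]; rewrite ?cv1 //= cvM IH -exprS. Qed.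
Lemma cv_fexp2 x n : cv (fexp x n).2 = cv x.2 ^+ n.
Proof. by elim: n => [|n IH]; rewrite ?cv1 //= cvM IH -exprS. Qed.

Definition valid (w : value) : bool :=
  [&& (0 < w.1)%N, cv w.2.1 != 0 & cv w.2.2 != 0].
Definition hits (y : L) (w : value) : bool := veq (cv w.2.1 * y ^+ w.1) (cv w.2.2).
(** A finite value is realized by an actual element of [L], with an exact equality instead of one up
    to a unit; computations with values become computations in [L]. *)
Definition repr_by (w : value) (g : L) : Prop :=
  [/\ valid w, g != 0 & cv w.2.1 * g ^+ w.1 = cv w.2.2].

Lemma valid_repr w : valid w -> exists g, repr_by w g.
Proof.
move=> vw; have /and3P[m0 p0 q0] := vw.
have /closed_rootP[g] : size ('X^(w.1) - (cv w.2.2 / cv w.2.1)%:P : {poly L}) != 1.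
  by rewrite size_XnsubC // eqSS -lt0n.
rewrite /root !hornerE subr_eq0 => /eqP E.
exists g; split => //; last by rewrite E mulrCA divff ?mulr1.
apply: contraNneq q0 => g0; move: E; rewrite g0 expr0n gtn_eqF // => /esym/eqP.
by rewrite mulf_eq0 invr_eq0 (negPf p0) orbF.
Qed.

Lemma hitsE w g y : repr_by w g -> hits y w = veq y g.
Proof.
case=> /and3P[m0 p0 q0] _ E.
by rewrite /hits -E veq_pM2l // veqXn.
Qed.

(** The fraction of [w] is [g^(-m)]. After multiplication by [g^n g'^n], [n = m m'], the test
    compares [g'^n] with [g^n], and torsion-freeness removes the exponent. *)
Lemma veqbE w w' g g' : repr_by w g -> repr_by w' g' -> veqb dvd c w w' = veq g g'.
Proof.
case=> /and3P[m0 p0 q0] g0 E [/and3P[m0' p0' q0'] g0' E'].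
rewrite /veqb /feq !fleE ?cv_fexp2 ?expf_neq0 // !fvX -[_ && _]/(veq _ _).
have F : fv w.2 = (g ^+ w.1)^-1 by rewrite /fv -E invfM mulrA divff // mul1r.
have F' : fv w'.2 = (g' ^+ w'.1)^-1 by rewrite /fv -E' invfM mulrA divff // mul1r.
have M0 : (0 < w.1 * w'.1)%N by rewrite muln_gt0 m0.
rewrite F F' !exprVn -!exprM [(w'.1 * _)%N]mulnC.
set n := (w.1 * _)%N in M0 *.
rewrite -(veq_pM2l VL _ _ (mulf_neq0 (expf_neq0 n g0) (expf_neq0 n g0'))).
rewrite mulrAC divff ?expf_neq0 // mul1r mulfK ?expf_neq0 //.
by rewrite veq_sym veqXn.
Qed.

Lemma repr_mul w w' g g' : repr_by w g -> repr_by w' g' ->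
  repr_by (vmul w w') (g * g').
Proof.
case=> /and3P[m0 p0 q0] g0 E [/and3P[m0' p0' q0'] g0' E'].
split; rewrite ?mulf_neq0 //.
  by rewrite /valid /= !cvM !cv_fexp1 !cv_fexp2 !mulf_neq0 ?expf_neq0 // muln_gt0 m0 m0'.
rewrite /= !cvM !cv_fexp1 !cv_fexp2 -E -E' !exprMn -!exprM [(w'.1 * w.1)%N]mulnC.
by ring.
Qed.

Lemma repr_exp w g n : repr_by w g -> repr_by (vexp w n) (g ^+ n).
Proof.
case=> /and3P[m0 p0 q0] g0 E; split; rewrite ?expf_neq0 //.
  by rewrite /valid /= cv_fexp1 cv_fexp2 !expf_neq0 // m0.
by rewrite /= cv_fexp1 cv_fexp2 -E exprMn exprAC.
Qed.

Lemma hits_neq0 y w : valid w -> hits y w -> y != 0.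
Proof.
move=> vw; have [g gP] := valid_repr vw; rewrite (hitsE _ gP).
by case: gP => _ g0 _ /(veq0) E; rewrite E.
Qed.

Lemma hits_veqb y w w' : valid w -> valid w' -> hits y w ->
  veqb dvd c w w' = hits y w'.
Proof.
move=> /valid_repr[g gP] /valid_repr[g' gP']; rewrite (hitsE _ gP) (hitsE _ gP').
by rewrite (veqbE gP gP') => /(veql HV) ->.
Qed.

Lemma hits_computes y w : valid w -> hits y w -> computes_value j VL c w y.
Proof.
move=> vw hy; have y0 := hits_neq0 vw hy; case/and3P: vw => m0 p0 q0.
split => //; first by apply: contraNneq p0 => p0; rewrite /(cv _) p0 rmorph0.
exists (cv w.2.1 * y ^+ w.1 / cv w.2.2); last by rewrite divfK.
have n0 : cv w.2.1 * y ^+ w.1 != 0 by rewrite mulf_neq0 ?expf_neq0.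
move: hy => /andP[]; rewrite !/(vle _ _) (negPf n0) (negPf q0) => h1 h2.
by split=> //; rewrite ?invf_div // mulf_neq0 ?invr_eq0.
Qed.

Section Newton.
Variables (cl : seq fexpr) (ys : seq L).
Hypothesis den_cl : forall l, cv (nth f0 cl l).2 != 0.
Hypothesis clE : \poly_(l < size cl) fv (nth f0 cl l) = \prod_(y <- ys) ('X - y%:P).

Let chi := \prod_(y <- ys) ('X - y%:P).
Let chiE l : chi`_l = fv (nth f0 cl l).
Proof.
rewrite /chi -clE coef_poly; case: ltnP => // ge.
by rewrite nth_default // fv0.
Qed.

(** The weights are the [m]-th powers of the [chi_l g^l], so their first and last minimal indices
    are the ends [a] and [b] of [newton_prod]. *)
Lemma mult_count w g : repr_by w g -> mult dvd c cl w = count (veq g) ys.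
Proof.
move=> gP; have [/and3P[m0 p0 q0] g0 Eg] := gP.
rewrite -(count_veq HV g ys) /mult; set W := weights cl w.
have [mu] := newton_prod HV ys g0.
set a := count _ ys; set b := count _ ys; rewrite -/chi => -[mu0 Hall [Ha Hb] Hlo Hhi].
have lt_size l : vle (chi`_l * g ^+ l) mu -> (l < size cl)%N.
  rewrite ltnNge => le; apply: contraTN le => ge.
  by rewrite chiE nth_default // fv0 mul0r vle0x.
have szW : size W = size cl by rewrite size_mkseq.
have WE l : (l < size cl)%N -> nth f0 W l = fmul (fexp (nth f0 cl l) w.1) (fexp (w.2.2, w.2.1) l).
  by move=> lt; rewrite nth_mkseq.
have denW l : cv (nth f0 W l).2 != 0.
  have [lt|ge] := ltnP l (size cl); last by rewrite nth_default ?szW // cv1 oner_neq0.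
  by rewrite WE //= cvM !cv_fexp2 mulf_neq0 ?expf_neq0.
have fvW l : fv (nth f0 W l) = (chi`_l * g ^+ l) ^+ w.1.
  have [lt|ge] := ltnP l (size cl); last first.
    by rewrite chiE !nth_default ?szW // fv0 mul0r expr0n gtn_eqF.
  rewrite WE // fvM !fvX chiE [RHS]exprMn exprAC; congr (_ * _ ^+ _).
  by rewrite /(fv _) /= -Eg mulrAC divff // mul1r.
have minE l : ismin dvd c W (nth f0 W l) = vle (chi`_l * g ^+ l) mu.
  have leE l' : fle dvd c (nth f0 W l) (nth f0 W l') = vle (chi`_l * g ^+ l) (chi`_l' * g ^+ l').
    by rewrite fleE // !fvW vleXn.
  apply/idP/idP => [/(all_nthP f0) H|H].
    by apply: (vle_trans HV _ Ha); rewrite -leE; apply: H; rewrite szW; apply: lt_size.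
  by apply/(all_nthP f0) => l' _; rewrite leE (vle_trans HV H).
congr subn.
  (* The index [size cl], also tested by [maxsat], reads the default [f0], of infinite value. *)
  apply: maxsat_eq; rewrite ?minE ?(ltnW (lt_size _ Hb)) // => n /andP[lt _].
  by rewrite minE Hhi.
have aW : (a < size W)%N by rewrite szW lt_size.
have hasW : has (ismin dvd c W) W.
  by apply/(has_nthP f0); exists a; rewrite // minE.
apply/eqP; rewrite eqn_leq; apply/andP; split; rewrite leqNgt; apply/negP => lt.
  by have := before_find f0 lt; rewrite minE Ha.
by have := nth_find f0 hasW; rewrite minE (negPf (Hlo _ lt)).
Qed.

Lemma all_mkflat (T : Type) (P : pred T) (f : nat -> seq T) n :
  all P (flatten (mkseq f n)) = all (fun i => all P (f i)) (iota 0 n).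
Proof. by rewrite all_flatten all_map. Qed.

Lemma has_mkflat (T : Type) (P : pred T) (f : nat -> seq T) n :
  has P (flatten (mkseq f n)) = has (fun i => has P (f i)) (iota 0 n).
Proof. by rewrite has_flatten has_map. Qed.

Lemma slopes_valid : all valid (slopes c cl).
Proof.
rewrite all_mkflat; apply/allP => a _; rewrite all_mkflat; apply/allP => m _.
rewrite /slope !(is0E inj_j); case: eqP => //= /eqP x0; case: eqP => //= /eqP y0.
by rewrite andbT /valid /= !cvM !mulf_neq0.
Qed.

(** Apply [newton_prod] with [g = y]. The edge has positive length because it counts [y] itself, and
    its ends satisfy [v(chi_a y^a) = v(chi_b y^b)], which makes [y] hit the slope from [a] to
    [b]. *)
Lemma slopes_hit y : y \in ys -> y != 0 -> has (hits y) (slopes c cl).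
Proof.
move=> ysy y0; have [mu] := newton_prod HV ys y0.
set a := count _ ys; set b := count _ ys; rewrite -/chi => -[mu0 Hall [Ha Hb] _ _].
have lt_size l : vle (chi`_l * y ^+ l) mu -> (chi`_l != 0) && (l < size cl)%N.
  move=> le; have n0 : chi`_l != 0.
    by apply: contraTneq le => ->; rewrite mul0r vle0x.
  rewrite n0 ltnNge; apply: contraNN n0 => ge.
  by rewrite chiE nth_default // fv0.
have /andP[a0 ltas] := lt_size _ Ha; have /andP[b0 ltbs] := lt_size _ Hb.
have ltab : (a < b)%N.
  have := count_veq HV y ys; rewrite -/a -/b => E.
  have : has (veq y) ys by apply/hasP; exists y; rewrite // veqxx.
  by rewrite has_count -E subn_gt0.
rewrite has_mkflat; apply/hasP; exists a; first by rewrite mem_iota.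
rewrite has_mkflat; apply/hasP; exists (b - a).-1.
  by rewrite mem_iota /= add0n; lia.
have -> : (a + (b - a).-1.+1)%N = b by lia.
rewrite /slope -!(fv_eq0 inj_j) // -!chiE (negPf a0) (negPf b0) /= orbF /hits /=.
have -> : (b - a).-1.+1 = (b - a)%N by lia.
have /andP[n0 d0] : (cv (nth f0 cl a).1 != 0) && (cv (nth f0 cl b).1 != 0).
  by rewrite -!(is0E inj_j) -!(fv_eq0 inj_j) // -!chiE a0.
rewrite !cvM -(veq_pM2l VL (z := y ^+ a / (cv (nth f0 cl a).2 * cv (nth f0 cl b).2))).
  have -> : y ^+ a / (cv (nth f0 cl a).2 * cv (nth f0 cl b).2) *
     (cv (nth f0 cl a).2 * cv (nth f0 cl b).1 * y ^+ (b - a)) = chi`_b * y ^+ b.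
    have -> : y ^+ b = y ^+ a * y ^+ (b - a) by rewrite -exprD subnKC // ltnW.
    by rewrite chiE /(fv _); field; rewrite !den_cl.
  have -> : y ^+ a / (cv (nth f0 cl a).2 * cv (nth f0 cl b).2) *
     (cv (nth f0 cl a).1 * cv (nth f0 cl b).2) = chi`_a * y ^+ a.
    by rewrite chiE /(fv _); field; rewrite !den_cl.
  by apply/andP; split; apply: (vle_trans HV); [exact: Hb|exact: Hall|exact: Ha|exact: Hall].
by rewrite mulf_neq0 ?invr_eq0 ?mulf_neq0 ?expf_neq0.
Qed.

End Newton.

Lemma undupv_valid l : all valid l -> all valid (undupv dvd c l).
Proof. by elim: l => //= w l IH /andP[vw /IH vl]; case: ifP => //= _; rewrite vw. Qed.

(** When [y] hits [w], being a duplicate of [w] is the same as being hit by [y], so exactly one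
    representative is kept. *)
Lemma count_undupv y l : all valid l ->
  count (hits y) (undupv dvd c l) = has (hits y) l.
Proof.
elim: l => //= w l IH /andP[vw vl]; have vu := undupv_valid vl.
have hb : hits y w -> has (veqb dvd c w) (undupv dvd c l) = has (hits y) l.
  move=> hw; have -> : has (hits y) l = has (hits y) (undupv dvd c l).
    by rewrite [RHS]has_count IH //; case: (has _ l).
  by elim: (undupv dvd c l) vu => //= w' u IHu /andP[vw' /IHu ->]; rewrite (hits_veqb vw vw' hw).
case: ifP hb => _ /= hb; rewrite (IH vl); case: (hits y w) hb => //= /(_ isT) <- //.
Qed.

End Values.

(** * Joint values *)

Lemma In_map (A B : Type) (f : A -> B) (s : seq A) y :
  List.In y (map f s) <-> exists2 x, List.In x s & y = f x.
Proof.
elim: s => [|a s IH] /=; first by split=> // -[].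
split=> [[<-|/IH[x xs ->]]|[x [<-|xs] E]]; [by exists a; auto|by exists x; auto|by left|].
by right; apply/IH; exists x.
Qed.

Lemma In_cat (A : Type) (s t : seq A) x : List.In x (s ++ t) <-> List.In x s \/ List.In x t.
Proof. by elim: s => [|a s IH] /=; tauto. Qed.

Lemma In_pairs (A B : Type) (s : seq A) (t : seq B) q :
  List.In q (pairs s t) <-> List.In q.1 s /\ List.In q.2 t.
Proof.
rewrite /pairs; elim: s => [|a s IH] /=; first by split=> // -[].
rewrite In_cat IH In_map; split=> [[[b tb ->]|]|[[E|qs] qt]]; try (simpl; tauto).
by left; exists q.2; rewrite // E; case: (q).
Qed.

Lemma all_In (A : Type) (P : pred A) s x : all P s -> List.In x s -> P x.
Proof. by elim: s => //= a s IH /andP[Pa /IH{}IH] [<-|]. Qed.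

Lemma has_In (A : Type) (P : pred A) s : has P s -> exists2 x, List.In x s & P x.
Proof.
elim: s => //= a s IH /orP[Pa|/IH[x xs Px]]; first by exists a; auto.
by exists x; auto.
Qed.

Lemma eq_count_In (A : Type) (P Q : pred A) s :
  (forall x, List.In x s -> P x = Q x) -> count P s = count Q s.
Proof. by elim: s => //= a s IH H; rewrite IH ?H; auto. Qed.

Lemma count_pairs (A B : Type) (P : pred A) (Q : pred B) s t :
  count (fun q => P q.1 && Q q.2) (pairs s t) = (count P s * count Q t)%N.
Proof.
elim: s => //= a s IH; rewrite /pairs /= count_cat -/(pairs s t) IH mulnDl; congr addn.
rewrite count_map (@eq_count _ _ (fun b => P a && Q b)) //.
by case: (P a); rewrite ?mul1n ?mul0n ?count_pred0.
Qed.

(* each [t] excludes at most one candidate, so [size s + 1] candidates suffice *)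
Lemma avoid_all (A : Type) (bad : A -> nat -> bool) (s : seq A) (cand : seq nat) :
  uniq cand -> (size s < size cand)%N ->
  (forall t n m, List.In t s -> n \in cand -> m \in cand ->
     bad t n -> bad t m -> n = m) ->
  exists2 n, n \in cand & all (fun t => ~~ bad t n) s.
Proof.
elim: s cand => [|t s IH] cand uc lt once.
  by case: cand lt {uc once} => // n cand _; exists n; rewrite ?mem_head.
pose cand' := [seq n <- cand | ~~ bad t n].
have lt1 : (count (bad t) cand <= 1)%N.
  rewrite -size_filter; case E: (filter _ _) => [|n [|m l]] //.
  have := filter_uniq (bad t) uc; rewrite E /= inE negb_or => /andP[/andP[/eqP ne _] _].
  have /andP[b1 n1] : bad t n && (n \in cand) by rewrite -mem_filter E mem_head.
  have /andP[b2 n2] : bad t m && (m \in cand) by rewrite -mem_filter E !inE eqxx orbT.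
  by case: ne; apply: once b1 b2; first by left.
have sz : (size s < size cand')%N.
  have := count_predC (bad t) cand; rewrite /cand' size_filter -[count (fun n => ~~ bad t n) _]/(count (predC (bad t)) _).
  by move: lt => /=; lia.
have [t' m p t's|n] := IH cand' (filter_uniq _ uc) sz.
  by rewrite !mem_filter => /andP[_ mc] /andP[_ pc]; apply: once => //; right.
by rewrite mem_filter => /andP[ntn nc] alln; exists n; rewrite //= ntn.
Qed.

Section Joint.
Variables (S : comNzRingType) (L : closedFieldType) (j : {rmorphism S -> L}).
Hypothesis inj_j : injective j.
Variables (VL : {pred L}) (dvd : rel S) (c : seq S).
Hypothesis HV : is_valuation_ring VL.
Hypothesis dvdE : forall a b, dvd a b = vle VL (j a) (j b).
Local Notation cv := (cv j c).
Local Notation fv := (fv j c).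
Local Notation valid := (valid j c).
Local Notation hits := (hits j VL c).
Local Notation computes := (computes_value j VL c).
Local Notation at_pt := (at_pt j c).
Local Notation below := (below j c).

Variables (k : nat) (R : seq (seq L)) (chp : spoly -> seq fexpr).
Hypothesis chp_den : forall h l, cv (nth f0 (chp h) l).2 != 0.
Hypothesis chpE : forall h, below k h ->
  \poly_(l < size (chp h)) fv (nth f0 (chp h) l)
  = \prod_(x <- R) ('X - (at_pt x h)%:P).

Definition hit (x : seq L) (e : entry) := hits (at_pt x e.1) e.2.1.

(** The second clause makes the entries a partition of the root vectors. The third says that any
    nonzero value of any of the polynomials is among the candidates; without it a sum could coincide
    with one for values outside the list, which separation does not control. *)
Definition exact_entries (J : seq entry) (hs : seq spoly) : Prop :=
  [/\ forall e, List.In e J -> below k e.1 /\ valid e.2.1,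
      {in R, forall x, count (hit x) J = 1%N},
      forall e, List.In e J -> {in R, forall x, at_pt x e.1 != 0 ->
        exists2 e', List.In e' J & hits (at_pt x e.1) e'.2.1}
    & forall e, List.In e J -> {in R, forall x, hit x e ->
        List.Forall2 computes e.2.2 [seq at_pt x h | h <- hs]}].

Lemma exact_entries_nil : exact_entries [:: (spcst f1, ((1%N, f1), [::]))] [::].
Proof.
have v1 : valid (1%N, f1) by rewrite /(valid _) /= cv1 oner_neq0.
have h1 x : hits (at_pt x (spcst f1)) (1%N, f1).
  by rewrite /(hits _ _) /at_pt ev_cst /= cv1 fv1 mul1r veqxx.
split=> [e [<-|//]|x _|e [<-|//] x _ _|e [<-|//] x _ _] /=.
- by split=> //; apply: below_cst.
- by rewrite /hit h1.
- by exists (spcst f1, ((1%N, f1), [::])); [left|].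
by constructor.
Qed.

(** Root vectors with [h(x) != 0] hit exactly one slope, those with [h(x) = 0] only the entry of
    [q(h)]. *)
Lemma exact_entries_single h : below k h ->
  exact_entries (entries dvd c (chp h) h) [:: h].
Proof.
move=> Bh; have E := chpE Bh; have den := chp_den h.
set cl := chp h in E den *; set chi := \prod_(x <- R) _ in E.
have chiE l : chi`_l = fv (nth f0 cl l).
  by rewrite -E coef_poly; case: ltnP => // ge; rewrite nth_default // fv0.
set s := lowest c cl.
have lowP l : (l < s)%N -> fv (nth f0 cl l) = 0.
  move=> lt; apply/eqP; rewrite (fv_eq0 inj_j) //.
  by have := before_find f0 lt => /negbFE.
have ns0 : fv (nth f0 cl s) != 0.
  have hs : has (fun x => ~~ is0 c x.1) cl.
    apply/(has_nthP f0); have mon : chi \is monic by apply: monic_prod_XsubC.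
    have n0 : chi`_(size chi).-1 != 0 by rewrite -lead_coefE (monicP mon) oner_neq0.
    exists (size chi).-1; last by rewrite -(fv_eq0 inj_j) // -chiE.
    by rewrite ltnNge; apply: contraNN n0 => ge; rewrite chiE nth_default ?fv0.
  by rewrite (fv_eq0 inj_j) //; apply: (nth_find f0 hs).
have scl : (s < size cl)%N.
  by rewrite ltnNge; apply: contraNN ns0 => ge; rewrite nth_default // fv0.
pose w0 : value := (1%N, ((nth f0 cl s).2, (nth f0 cl s).1)).
have vw0 : valid w0.
  by rewrite /(valid _) /= den /= -(is0E inj_j) -(fv_eq0 inj_j).
set q := cofactor_at0 c cl h.
have atq x : at_pt x q = \sum_(l < size cl) fv (nth f0 cl (s + l)) * at_pt x h ^+ l.
  rewrite /at_pt ev_flatten big_map -{1}[size cl]subn0 -/(index_iota 0 (size cl)) big_mkord.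
  by apply: eq_bigr => l _; rewrite ev_mul ev_cst ev_exp.
(* For [y = h(x)], [y^s q(y) = chi(y) = 0], and [y^s] can be cancelled. *)
have atq_y x : x \in R -> at_pt x h != 0 -> at_pt x q = 0.
  move=> xR y0; set y := at_pt x h in y0 *; apply: (mulfI (expf_neq0 s y0)).
  have chi0 : chi.[y] = 0.
    rewrite /chi horner_prod; apply/eqP; rewrite prodf_seq_eq0.
    by apply/hasP; exists x; rewrite //= hornerXsubC subrr.
  rewrite mulr0 -chi0 -E horner_poly atq big_distrr /=.
  rewrite -(big_mkord xpredT (fun l => y ^+ s * (fv (nth f0 cl (s + l)) * y ^+ l))).
  rewrite -(big_mkord xpredT (fun l => fv (nth f0 cl l) * y ^+ l)).
  rewrite [RHS](big_cat_nat (n := s) (p := size cl)) ?(ltnW scl) //=.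
  rewrite [X in _ = X + _]big_nat_cond [X in _ = X + _]big1 => [|l /andP[/andP[_ lt] _]]; last first.
    by rewrite lowP // mul0r.
  (* On the right the terms below [s] are gone and the rest is shifted; on the left those from
     [size cl - s] on read the default 0. *)
  rewrite add0r -[in RHS](add0n s) big_addn.
  rewrite [LHS](big_cat_nat (n := size cl - s) (p := size cl)) ?leq_subr //=.
  rewrite [X in _ + X]big_nat_cond [X in _ + X]big1 => [|l /andP[/andP[ge _] _]]; last first.
    by rewrite nth_default ?fv0 ?mul0r ?mulr0 // -leq_subLR.
  rewrite addr0; apply: eq_bigr => l _.
  by rewrite [(l + s)%N]addnC exprD mulrCA.
have atq_0 x : at_pt x h = 0 -> at_pt x q = fv (nth f0 cl s).
  move=> y0; rewrite atq -(ltn_predK scl) big_ord_recl /= addn0 expr0 mulr1.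
  by rewrite big1 ?addr0 // => l _; rewrite y0 expr0n /= mulr0.
have hit_q x : x \in R -> hits (at_pt x q) w0 = (at_pt x h == 0).
  move=> xR; case: eqVneq => [/atq_0 ->|/(atq_y _ xR) ->].
    by rewrite /(hits _ _) /= /(fv _) mulrCA divff // mulr1 veqxx.
  by apply/negP => /(hits_neq0 HV vw0); rewrite eqxx.
have vs := slopes_valid inj_j den; have vu := undupv_valid dvd vs.
have hit_h x : x \in R ->
    count (hits (at_pt x h)) (undupv dvd c (slopes c cl)) = (at_pt x h != 0).
  move=> xR; rewrite (count_undupv HV dvdE) //; congr nat_of_bool.
  apply/idP/idP => [/has_In[w /(all_In vs) vw]|y0]; first exact: hits_neq0.
  apply: (slopes_hit inj_j HV den (ys := [seq at_pt x h | x <- R])) => //.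
    by rewrite big_map.
  exact: map_f.
have InE e : List.In e (entries dvd c cl h) <->
    (exists2 w, List.In w (undupv dvd c (slopes c cl)) & e = (h, (w, [:: w]))) \/
    e = (q, (w0, [:: (1%N, (IOne, IZero))])).
  rewrite /entries In_cat In_map /=; split=> [[?|[<-|//]]|[?|->]]; auto.
split.
- move=> e /InE[[w /(all_In vu) vw ->]|->] //; split=> //=.
  apply: below_flatten => l; apply: below_mul; first exact: below_cst.
  exact: below_exp.
- move=> x xR; rewrite count_cat count_map /= -[count _ (undupv _ _ _)]/(count (hits (at_pt x h)) _).
  by rewrite hit_h // addn0 -/w0 /hit /= hit_q //; case: eqP.
- move=> e /InE[[w _ ->]|->] x xR /= n0.
    have /has_In[w' w'u hw'] : has (hits (at_pt x h)) (undupv dvd c (slopes c cl)).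
      by rewrite has_count hit_h // n0.
    by exists (h, (w', [:: w'])) => //; apply/InE; left; exists w'.
  exists (q, (w0, [:: (1%N, (IOne, IZero))])); first by apply/InE; right.
  by rewrite hit_q //; apply: contraNT n0 => /(atq_y _ xR) ->.
move=> e /InE[[w /(all_In vu) vw ->]|->] x xR; rewrite /hit /= => hx.
  by constructor => //; apply: hits_computes.
constructor=> //; move: hx; rewrite hit_q // => /eqP ->.
split; rewrite //= ?rmorph1 ?oner_neq0 //; exists 1; last by rewrite /= rmorph0 expr1 !mulr0.
by case: HV => -[V1 _ _] _; split; rewrite ?invr1 ?oner_neq0.
Qed.

(** Subtracting the two equalities gives [(m - n) v(g2) = (m - n) v(g2')]; torsion-freeness yields
    [v(g2) = v(g2')], and then [v(g1) = v(g1')]. *)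
Lemma bad_once g1 g2 g1' g2' n m : (n < m)%N ->
  g1 != 0 -> g2 != 0 -> g1' != 0 -> g2' != 0 ->
  veq VL (g1 * g2 ^+ n) (g1' * g2' ^+ n) ->
  veq VL (g1 * g2 ^+ m) (g1' * g2' ^+ m) ->
  veq VL g1 g1' && veq VL g2 g2'.
Proof.
move=> lt n1 n2 n1' n2' En.
rewrite -(subnKC (ltnW lt)) !exprD !mulrA => Em.
have E2 : veq VL g2 g2'.
  rewrite -(veqXn HV (m := m - n)) ?subn_gt0 //.
  rewrite -(veq_pM2l VL _ _ (mulf_neq0 n1 (expf_neq0 n n2))).
  apply: (veq_trans HV Em); rewrite -(veqr HV (x := g1 * g2 ^+ n * g2' ^+ (m - n))) ?veqxx //.
  by apply: veqM => //; rewrite ?veqxx // veq_sym.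
rewrite E2 andbT -(veq_pM2l VL _ _ (expf_neq0 n n2)) mulrC (veq_trans HV En) //.
rewrite mulrC; apply: veqM; rewrite ?veqxx //.
by rewrite veq_sym veqX.
Qed.

Lemma sep_exponentP s t :
  (forall e, List.In e s -> valid e.2.1) -> (forall e, List.In e t -> valid e.2.1) ->
  (0 < sep_exponent dvd c s t)%N /\
  forall q, List.In q (pairs (pairs s t) (pairs s t)) ->
     separates dvd c (sep_exponent dvd c s t) q.
Proof.
move=> vs vt; set Q := pairs (pairs s t) _.
have sepE e1 e2 e1' e2' g1 g2 g1' g2' n :
    repr_by j c e1.2.1 g1 -> repr_by j c e2.2.1 g2 ->
    repr_by j c e1'.2.1 g1' -> repr_by j c e2'.2.1 g2' ->
    separates dvd c n ((e1, e2), (e1', e2')) =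
    (veq VL (g1 * g2 ^+ n) (g1' * g2' ^+ n) ==> veq VL g1 g1' && veq VL g2 g2').
  move=> P1 P2 P1' P2'; rewrite /separates /= (veqbE HV dvdE P1 P1') (veqbE HV dvdE P2 P2').
  by rewrite (veqbE HV dvdE (repr_mul P1 (repr_exp n P2)) (repr_mul P1' (repr_exp n P2'))).
have once q n m : List.In q Q -> ~~ separates dvd c n q -> ~~ separates dvd c m q ->
    (n < m)%N -> False.
  case: q => [[e1 e2] [e1' e2']] /In_pairs[/In_pairs[/= i1 i2] /In_pairs[/= i1' i2']].
  have [g1 P1] := valid_repr (vs _ i1); have [g2 P2] := valid_repr (vt _ i2).
  have [g1' P1'] := valid_repr (vs _ i1'); have [g2' P2'] := valid_repr (vt _ i2').
  rewrite !(sepE _ _ _ _ _ _ _ _ _ P1 P2 P1' P2') !negb_imply => /andP[En ne] /andP[Em _] lt.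
  by move: ne; rewrite (bad_once lt _ _ _ _ En Em) //; [case: P1|case: P2|case: P1'|case: P2'].
(* Candidates start at 1: the exponent 0 would erase the second polynomial. *)
have [||n] := @avoid_all _ (fun q n => ~~ separates dvd c n q) Q (iota 1 (size Q).+1) (iota_uniq _ _).
- by rewrite size_iota.
- move=> q n m qQ _ _ bn bm; case: (ltngtP n m) => // lt; first by case: (once _ _ _ qQ bn bm lt).
  by case: (once _ _ _ qQ bm bn lt).
rewrite mem_iota add1n => /andP[n1 n2] alln.
have [] := @maxsat_sat (fun N => all (separates dvd c N) Q) (size Q).+1.
  by exists n; rewrite ?n1 //; apply: sub_all alln => q; rewrite negbK.
by move=> N0 allN; split=> // q qQ; apply: (all_In allN).
Qed.

(** Everything rests on [hitE]: a merged entry is hit exactly when both of its parts are. The four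
    clauses then follow from those of [s] and [t]. *)
Lemma combine_exact s t hs hs' : exact_entries s hs -> exact_entries t hs' ->
  exact_entries (combine dvd c s t) (hs ++ hs').
Proof.
move=> [s1 s2 s3 s4] [t1 t2 t3 t4].
have [] := @sep_exponentP s t (fun e i => proj2 (s1 e i)) (fun e i => proj2 (t1 e i)).
rewrite /combine; set N := sep_exponent _ _ _ _ => N0 sep.
have InE e : List.In e [seq merge_entries N q.1 q.2 | q <- pairs s t] <->
    exists a b, [/\ List.In a s, List.In b t & e = merge_entries N a b].
  rewrite In_map; split=> [[[a b] /In_pairs[ia ib] ->]|[a [b [ia ib ->]]]].
    by exists a, b.
  by exists (a, b) => //; apply/In_pairs.
have at_merge x a b : at_pt x (merge_entries N a b).1 = at_pt x a.1 * at_pt x b.1 ^+ N.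
  by rewrite /at_pt ev_mul ev_exp.
have hits_merge y z a b : List.In a s -> List.In b t ->
    hits y a.2.1 -> hits z b.2.1 -> hits (y * z ^+ N) (merge_entries N a b).2.1.
  move=> ia ib; have [g P] := valid_repr (proj2 (s1 _ ia)).
  have [g' P'] := valid_repr (proj2 (t1 _ ib)).
  rewrite (hitsE HV _ P) (hitsE HV _ P') (hitsE HV _ (repr_mul P (repr_exp N P'))) => hy hz.
  by apply: veqM => //; apply: veqX.
have valid_merge a b : List.In a s -> List.In b t -> valid (merge_entries N a b).2.1.
  move=> ia ib; have [g P] := valid_repr (proj2 (s1 _ ia)).
  have [g' P'] := valid_repr (proj2 (t1 _ ib)).
  by case: (repr_mul P (repr_exp N P')).
have split0 x a b : at_pt x (merge_entries N a b).1 != 0 ->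
    at_pt x a.1 != 0 /\ at_pt x b.1 != 0.
  by rewrite at_merge mulf_eq0 expf_eq0 N0 negb_or => /andP.
have hitE x a b : x \in R -> List.In a s -> List.In b t ->
    hit x (merge_entries N a b) = hit x a && hit x b.
  move=> xR ia ib; apply/idP/andP => [hm|[ha hb]]; last first.
    by rewrite /hit at_merge; apply: hits_merge.
  have [na nb] := split0 _ _ _ (hits_neq0 HV (valid_merge _ _ ia ib) hm).
  (* [a'] and [b'] carry the actual values of [a.1] and [b.1] at [x]. Their merged value equals that
     of [a] and [b], so separation identifies the components. *)
  have [a' ia' ha'] := s3 _ ia _ xR na; have [b' ib' hb'] := t3 _ ib _ xR nb.
  have hm' := hits_merge _ _ _ _ ia' ib' ha' hb'.
  have := sep ((a', b'), (a, b)); rewrite /separates /=.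
  rewrite (hits_veqb HV dvdE _ _ hm') ?valid_merge // -at_merge -/(hit _ _) hm /=.
  rewrite (hits_veqb HV dvdE _ _ ha') ?(hits_veqb HV dvdE _ _ hb');
    try by [apply: (proj2 (s1 _ _)) | apply: (proj2 (t1 _ _))].
  by case/(_ _)/andP => //; apply/In_pairs; split; apply/In_pairs.
split.
- move=> e /InE[a [b [ia ib ->]]]; split; last exact: valid_merge.
  apply: below_mul; first exact: (proj1 (s1 _ ia)).
  by apply: below_exp; exact: (proj1 (t1 _ ib)).
- move=> x xR; rewrite count_map.
  rewrite (@eq_count_In _ _ (fun q => hit x q.1 && hit x q.2)).
    by rewrite count_pairs s2 // t2.
  by move=> [a b] /In_pairs[ia ib]; apply: hitE.
- move=> e /InE[a [b [ia ib ->]]] x xR /split0[na nb].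
  have [a' ia' ha'] := s3 _ ia _ xR na; have [b' ib' hb'] := t3 _ ib _ xR nb.
  exists (merge_entries N a' b'); last by rewrite at_merge; apply: hits_merge.
  by apply/InE; exists a', b'.
move=> e /InE[a [b [ia ib ->]]] x xR; rewrite hitE // => /andP[ha hb].
by rewrite map_cat; apply: List.Forall2_app; [apply: s4 | apply: t4].
Qed.

Lemma joint_exact hs : List.Forall (below k) hs ->
  exact_entries (foldr (fun h acc => combine dvd c (entries dvd c (chp h) h) acc)
     [:: (spcst f1, ((1%N, f1), [::]))] hs) hs.
Proof.
elim: hs => [|h hs IH] B; first exact: exact_entries_nil.
inversion B as [|h' hs' Bh Bhs]; exact: (combine_exact (exact_entries_single Bh) (IH Bhs)).
Qed.

Lemma perm_flatten_filter (A : eqType) (B : Type) (P : A -> pred B) (s : seq A) (t : seq B) :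
  {in s, forall x, count (P x) t = 1%N} ->
  perm_eq (flatten [seq [seq x <- s | P x b] | b <- t]) s.
Proof.
move=> H; apply/permP => a; rewrite count_flatten -map_comp sumnE big_map.
under eq_bigr => b _ do rewrite /= count_filter -sum1_count big_mkcond.
rewrite exchange_big /= -[RHS]sum1_count [RHS]big_mkcond; apply: eq_big_seq => x xs.
case: (a x) => /=; last by rewrite big1.
by rewrite -big_mkcond sum1_count H.
Qed.

Lemma Forall2_nseq (A B : Type) (Q : A -> B -> Prop) a (s : seq B) n :
  n = size s -> (forall b, List.In b s -> Q a b) -> List.Forall2 Q (nseq n a) s.
Proof.
move=> ->; elim: s => [|b s IH] H /=; constructor; first by apply: H; left.
by apply: IH => b' i; apply: H; right.
Qed.

Lemma mem_In (A : eqType) (s : seq A) x : List.In x s -> x \in s.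
Proof. by elim: s => //= a s IH [->|/IH xs]; rewrite inE ?eqxx // xs orbT. Qed.

(** By [mult_count], an entry is repeated as often as there are root vectors hitting it; listing the
    root vectors entry by entry permutes [R]. *)
Lemma values_correct hs J : exact_entries J hs ->
  exists2 tuples : seq (seq L),
    perm_eq tuples [seq [seq at_pt x h | h <- hs] | x <- R]
  & List.Forall2 (List.Forall2 computes)
      (flatten [seq nseq (mult dvd c (chp e.1) e.2.1) e.2.2 | e <- J]) tuples.
Proof.
move=> [J1 J2 _ J4].
exists [seq [seq at_pt x h | h <- hs] |
          x <- flatten [seq [seq x <- R | hit x e] | e <- J]].
  by apply: perm_map; apply: perm_flatten_filter => x; apply: J2.
(* The induction runs over a list [J'] of entries of [J], while the invariants stay those of [J]. *)
elim: {-2}J (fun (e : entry) => id : List.In e J -> List.In e J) => [|e J' IH] sub /=.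
  by constructor.
have eJ : List.In e J by apply: sub; left.
rewrite map_cat; apply: List.Forall2_app; last first.
  by apply: IH => e' i; apply: sub; right.
have [Be ve] := J1 _ eJ; have [g P] := valid_repr ve.
apply: Forall2_nseq.
  rewrite size_map size_filter.
  have E := chpE Be; rewrite -(big_map (fun x => at_pt x e.1) xpredT (fun y => 'X - y%:P)) in E.
  rewrite (mult_count HV dvdE (chp_den e.1) E P).
  rewrite count_map; apply: eq_count => x /=.
  by rewrite /hit (hitsE HV _ P) veq_sym.
move=> b /In_map[x /mem_In]; rewrite mem_filter => /andP[hx xR] ->.
exact: J4.
Qed.

End Joint.

(** * Triangular systems *)

Lemma prod_monomial_of (R : comNzRingType) (env : nat -> R) (P : pred nat) e :
  \prod_(l <- monomial_of e | P l) env l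
  = \prod_(l < size e | P l) env l ^+ nth 0%N e l.
Proof.
rewrite big_flatten big_map -{1}[size e]subn0 -/(index_iota 0 (size e)) big_mkord.
rewrite [RHS]big_mkcond; apply: eq_bigr => l _.
rewrite big_nseq_cond; case: (P l); first by rewrite iter_mulr_1.
by [].
Qed.

Lemma deg_in_monomial_of i e : deg_in i (monomial_of e) = nth 0%N e i.
Proof.
rewrite /deg_in count_flatten -map_comp sumnE big_map -{1}[size e]subn0 -/(index_iota 0 (size e)).
under eq_bigr => l _ do rewrite /= count_nseq.
rewrite big_mkord; have [lt|ge] := ltnP i (size e).
  rewrite (bigD1 (Ordinal lt)) //= eqxx mul1n big1 ?addn0 // => l ne.
  by rewrite -[_ == _ :> nat]/(l == Ordinal lt) (negPf ne).
rewrite big1 ?nth_default // => l _; rewrite ltn_eqF //; exact: leq_trans (ltn_ord l) ge.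
Qed.

Section Presentation.
Variables (S : comNzRingType) (K : fieldType) (L : closedFieldType).
Variables (iota : {rmorphism S -> K}) (phi : {rmorphism K -> L}).
Variable c : seq S.
Let j : {rmorphism S -> L} := phi \o iota.

Definition known (t : tyden S TPoly) :=
  all (fun u : seq nat * (S * S) => (u.2.1 \in c) && (u.2.2 \in c)) t.

Lemma ev_symbolic (t : tyden S TPoly) env : known t ->
  ev j c env (symbolic c t)
  = \sum_(u <- t) phi (iota u.2.1 / iota u.2.2)
      * \prod_(l < size u.1) env l ^+ nth 0%N u.1 l.
Proof.
move=> /allP kt; rewrite /ev big_map; apply: eq_big_seq => u /kt /andP[ka kb] /=.
by rewrite prod_monomial_of /fv /cv /= !nth_index //= fmorph_div.
Qed.

Lemma eval_at_presents n (t : tyden S TPoly) (P : {mpoly K[n]}) x :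
  presents iota t P -> known t ->
  eval_at phi P x = at_pt j c x (symbolic c t).
Proof.
move=> [/allP szt ->] kt; rewrite /at_pt ev_symbolic // /eval_at raddf_sum /=.
apply: eq_big_seq => u /szt /andP[/eqP <- _].
rewrite mmapZ mmapX /mmap1; congr (_ * _).
by apply: eq_bigr => l _; rewrite mnmE.
Qed.

Lemma below_presents n (t : tyden S TPoly) (P : {mpoly K[n]}) :
  presents iota t P -> known t -> below j c n (symbolic c t).
Proof.
move=> [/allP szt _] kt env env' E; rewrite !ev_symbolic //.
apply: eq_big_seq => u /szt /andP[/eqP sz _]; congr (_ * _).
by apply: eq_bigr => l _; rewrite E // -sz.
Qed.

Lemma muniX n (m : 'X_{1..n.+1}) :
  muni 'X_[m] = 'X_[[multinom m (widen_ord (leqnSn n) i) | i < n]] *: 'X^(m ord_max)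
  :> {poly {mpoly K[n]}}.
Proof. by rewrite muniE msuppX big_seq1 mcoeffX eqxx scale1r. Qed.

Lemma specialize_coef n (t : tyden S TPoly) (P : {mpoly K[n.+1]}) x env q :
  presents iota t P -> known t -> (forall l, (l < n)%N -> env l = x`_l) ->
  (specialize phi P x)`_q = ev j c env (coef_in n q (symbolic c t)).
Proof.
move=> [/allP szt ->] kt E; rewrite /specialize coef_map_id0 ?mmap0 //.
rewrite raddf_sum /= coef_sum raddf_sum /= ev_coef_in big_map [RHS]big_mkcond /=.
apply: eq_big_seq => u ut; have /andP[/eqP sz _] := szt _ ut.
have /andP[ka kb] := allP kt _ ut.
rewrite muniZ coefZ mul_mpolyC mmapZ muniX coefZ coefXn deg_in_monomial_of mnmE eq_sym.
case: eqP => _; last by rewrite mulr0 mmap0 mulr0.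
rewrite mulr1 mmapX /strip big_filter prod_monomial_of sz big_mkcond big_ord_recr /=.
rewrite eqxx mulr1 /fv /cv /= !nth_index //= fmorph_div; congr (_ * _).
rewrite /mmap1; apply: eq_bigr => l _; rewrite !mnmE ltn_eqF //= E //.
Qed.

(** The leading coefficient 1 survives specialization, so each partial root vector has the same
    number of extensions. *)
Lemma specialize_size n (P : {mpoly K[n.+1]}) x : muni P \is monic ->
  size (specialize phi P x) = (main_degree P).+1 /\ specialize phi P x \is monic.
Proof.
move=> mon; have n0 : mmap phi (fun l : 'I_n => x`_l) (lead_coef (muni P)) = 1.
  by rewrite (monicP mon) -mpolyC1 mmapC; exact: rmorph1.
have sz : size (specialize phi P x) = size (muni P).
  by rewrite /specialize size_map_poly_id0 // n0 oner_neq0.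
split.
  by rewrite sz /main_degree prednK // size_poly_gt0 monic_neq0.
by rewrite monicE /lead_coef sz coef_map_id0 ?mmap0 // -/(lead_coef _) n0.
Qed.

End Presentation.

Lemma known_coefficients (S : comNzRingType) (d : tyden S TInput) p :
  p \in d.1 ++ d.2 -> known (coefficients d) p.
Proof.
move=> pd; apply/allP => u up; apply/andP; split; apply/flatten_mapP; exists p => //;
  by apply/flatten_mapP; exists u; rewrite // !inE eqxx ?orbT.
Qed.

Lemma map_nth_enum (T : Type) (x0 : T) (s : seq T) n : size s = n ->
  [seq nth x0 s (val i) | i <- enum 'I_n] = s.
Proof.
move=> <-; rewrite (map_comp (nth x0 s) val) val_enum_ord; exact: mkseq_nth.
Qed.

(** The theorem for the function [solve]; what remains is to write this function as a program. *)
Lemma solve_correct (K : fieldType) (V : {pred K})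
   (S : comNzRingType) (iota : {rmorphism S -> K}) (dvd : rel S)
   (L : closedFieldType) (phi : {rmorphism K -> L}) (VL : {pred L}) :
    injective iota ->
    (forall a b : S,
       reflect (exists2 c : K, c \in V & iota b = c * iota a) (dvd a b)) ->
    is_valuation_ring VL ->
    (forall x : K, (phi x \in VL) = (x \in V)) ->
  forall (k r : nat) (P : forall i : 'I_k, {mpoly K[i.+1]})
         (Q : 'I_r -> {mpoly K[k]}) (input : tyden S TInput),
    triangular P ->
    size input.1 = k ->
    size input.2 = r ->
    (forall i : 'I_k, presents iota (nth [::] input.1 i) (P i)) ->
    (forall j : 'I_r, presents iota (nth [::] input.2 j) (Q j)) ->
  let R := root_vectors phi P in
  let tuples := [seq x ++ [seq eval_at phi (Q j) x | j <- enum 'I_r] | x <- R] in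
  size R = (\prod_(i < k) main_degree (P i))%N
  /\ exists2 tuples' : seq (seq L), perm_eq tuples' tuples
          & List.Forall2 (List.Forall2 (computes_value (fun s => phi (iota s)) VL
                                (coefficients input)))
              (solve dvd input) tuples'.
Proof.
move=> inj_i dvdP HV VLE k r P Q input triP sz1 sz2 pP pQ R tuples.
pose j : {rmorphism S -> L} := phi \o iota.
have inj_j : injective j by apply: inj_comp inj_i; apply: fmorph_inj.
have V0 : 0 \in V by rewrite -VLE rmorph0; case: HV => -[V1 VB _] _; rewrite -(subrr 1) VB.
(* Since [VL] induces [V] on K, divisibility in [V] is the order of values in [L]. The case [a = 0]
   is apart because [b / 0 = 0]. *)
have dvdE a b : dvd a b = vle VL (j a) (j b).
  rewrite /vle; case: eqP => [/eqP|/eqP] a0.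
    move: a0; rewrite -(rmorph0 j) !(inj_eq inj_j) => /eqP ->.
    apply/dvdP/eqP => [[x _]|->]; first by rewrite rmorph0 mulr0 -(rmorph0 iota) => /inj_i.
    by exists 0; rewrite // rmorph0 mulr0.
  have a0' : iota a != 0.
    by apply: contraNneq a0 => a0; rewrite /j /= a0 rmorph0.
  rewrite /= -fmorph_div VLE; apply/dvdP/idP => [[x Vx ->]|Vx]; first by rewrite mulfK.
  by exists (iota b / iota a); rewrite // divfK.
set c := coefficients input.
have kP (i : 'I_k) : known c (nth [::] input.1 i).
  by apply: known_coefficients; rewrite mem_cat mem_nth // sz1.
have kQ (i : 'I_r) : known c (nth [::] input.2 i).
  by apply: known_coefficients; rewrite mem_cat mem_nth ?orbT // sz2.
pose sp (i : 'I_k) x := specialize phi (P i) x.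
pose ps (i : 'I_k) := symbolic c (nth [::] input.1 i).
pose d (i : 'I_k) := main_degree (P i).
have sp_size i x : size (sp i x) = (d i).+1 by case: (specialize_size phi x (triP i)).
have sp_monic i x : sp i x \is monic by case: (specialize_size phi x (triP i)).
have psE (i : 'I_k) x env : (forall l, (l < i)%N -> env l = x`_l) ->
    forall n, ev j c env (coef_in i n (ps i)) = (sp i x)`_n.
  by move=> E n; rewrite -(specialize_coef _ _ (pP i) (kP i) E).
have RE : R = points sp by [].
split.
  by rewrite RE (size_extend sp_monic sp_size) mul1n big_enum.
set hs := mkseq spvar k ++ [seq symbolic c q | q <- input.2].
have sysE : mkseq (fun i => (i, symbolic c (nth [::] input.1 i))) k = system ps.
  by rewrite /mkseq -val_enum_ord -map_comp.
have Bhs : List.Forall (below j c k) hs.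
  apply/List.Forall_forall => h /In_cat[] /In_map[].
    by move=> i /mem_In; rewrite mem_iota => /andP[_ ik] ->; apply: below_var.
  move=> q /mem_In /(nthP [::]) [i ir <-] ->; rewrite sz2 in ir.
  exact: below_presents (pQ (Ordinal ir)) (kQ (Ordinal ir)).
have atE x : x \in R -> [seq at_pt j c x h | h <- hs]
    = x ++ [seq eval_at phi (Q j) x | j <- enum 'I_r].
  rewrite RE => /points_size szx; rewrite map_cat; congr cat.
    rewrite -[RHS](mkseq_nth 0) szx /mkseq -map_comp; apply: eq_map => i.
    by rewrite /= /at_pt ev_var.
  rewrite -map_comp -{1}(map_nth_enum [::] sz2) -map_comp; apply: eq_map => i /=.
  by rewrite (eval_at_presents phi x (pQ i) (kQ i)).
have chpE h (Bh : below j c k h) := charpE inj_j sp_monic sp_size psE Bh.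
have chp_den := charp_den inj_j c ps.
have J := joint_exact inj_j HV dvdE chp_den chpE Bhs.
have [t pt ft] := values_correct HV dvdE chp_den chpE J.
exists t; last first.
  by rewrite /solve sz1 sysE.
apply: (perm_trans pt); rewrite /tuples.
have -> : [seq x ++ [seq eval_at phi (Q j) x | j <- enum 'I_r] | x <- R]
   = [seq [seq at_pt j c x h | h <- hs] | x <- R].
  by apply/esym/eq_in_map => x; apply: atE.
by rewrite RE.
Qed.

(** * Programs *)

Definition holds (S : comNzRingType) (dvd : rel S) G (p : prog G TBool)
    (x : tyden S G) : bool :=
  if pden dvd p x is inl _ then true else false.

Arguments holds : simpl never.
Arguments tyden : simpl never.

(* Programs are locked and their equations are between functions, so that one can
   rewrite with these equations below binders. *)
Section Combinators.
Variables (G : ty).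
Implicit Types (A B : ty).

(* A context is a left-nested product; [v_i] is its component of de Bruijn index i,
   except for the outermost one, which is written [u_i]. *)
Definition v0 A : prog (TProd G A) A := PSnd G A.
Definition weak A B (p : prog G B) : prog (TProd G A) B := PComp p (PFst G A).
Definition tfst A B (p : prog G (TProd A B)) : prog G A := PComp (PFst A B) p.
Definition tsnd A B (p : prog G (TProd A B)) : prog G B := PComp (PSnd A B) p.
Definition app2 A B C (p : prog (TProd A B) C) (x : prog G A) (y : prog G B) :
  prog G C := PComp p (PPair x y).
Definition tunit A (p : prog TUnit A) : prog G A := PComp p (PTt G).
Definition ttrue : prog G TBool := PComp (PInl TUnit TUnit) (PTt G).
Definition tfalse : prog G TBool := PComp (PInr TUnit TUnit) (PTt G).

Definition tif A (b : prog G TBool) (x y : prog G A) : prog G A :=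
  locked (PComp (PCase (PComp x (PFst G TUnit)) (PComp y (PFst G TUnit))) (PPair (PId G) b)).

Definition tfoldr A B (l : prog G (TList A)) (z : prog G B)
    (s : prog (TProd (TProd G A) B) B) : prog G B :=
  locked (PComp (PListRec z (PComp s (PPair (PPair (PFst _ _) (PComp (PFst _ _) (PSnd _ _)))
                       (PComp (PSnd _ _) (PComp (PSnd _ _) (PSnd _ _))))))
        (PPair (PId G) l)).

Definition trec A (n : prog G TNat) (z : prog G A)
    (s : prog (TProd (TProd G TNat) A) A) : prog G A :=
  locked (PComp (PNatRec z (PComp s (PPair (PPair (PFst _ _) (PComp (PFst _ _) (PSnd _ _)))
                       (PComp (PSnd _ _) (PSnd _ _)))))
        (PPair (PId G) n)).

Definition tfirst A (x0 : prog G A) (l : prog G (TList A)) : prog G A :=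
  locked (PComp (PListRec x0 (PComp (PFst _ _) (PSnd _ _))) (PPair (PId G) l)).
Definition trest A (l : prog G (TList A)) : prog G (TList A) :=
  locked (PComp (PListRec (tunit (PNil A)) (PComp (PFst _ _) (PComp (PSnd _ _) (PSnd _ _))))
        (PPair (PId G) l)).

Section Equations.
Variables (S : comNzRingType) (dvd : rel S).
Local Notation pden := (pden dvd).
Local Notation holds := (holds dvd).

Lemma tifE A b (x y : prog G A) :
  pden (tif b x y) = fun z => if holds b z then pden x z else pden y z.
Proof. by apply: functional_extensionality => z; rewrite /tif -lock /= /holds; case: (pden b z). Qed.

Lemma holds_tif b x y :
  holds (tif b x y) = fun z => if holds b z then holds x z else holds y z.
Proof. by apply: functional_extensionality => z; rewrite /tif -lock /holds /=; case: (pden b z). Qed.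

Lemma holds_comp A (p : prog A TBool) (x : prog G A) :
  holds (PComp p x) = fun z => holds p (pden x z).
Proof. by []. Qed.

Lemma holds_true : holds ttrue = fun _ => true. Proof. by []. Qed.
Lemma holds_false : holds tfalse = fun _ => false. Proof. by []. Qed.

Lemma tfoldrE A B (l : prog G (TList A)) (z : prog G B) s :
  pden (tfoldr l z s) = fun x => foldr (fun a b => pden s ((x, a), b)) (pden z x) (pden l x).
Proof.
by rewrite /tfoldr -lock; apply: functional_extensionality => x /=; elim: (pden l x) => //= a t ->.
Qed.

Lemma trecE A n (z : prog G A) s :
  pden (trec n z s)
  = fun x => nat_primrec (pden z x) (fun i a => pden s ((x, i), a)) (pden n x).
Proof. by rewrite /trec -lock. Qed.

Lemma tfirstE A (x0 : prog G A) l :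
  pden (tfirst x0 l) = fun x => head (pden x0 x) (pden l x).
Proof. by rewrite /tfirst -lock; apply: functional_extensionality => x /=; case: (pden l x). Qed.

Lemma trestE A (l : prog G (TList A)) :
  pden (trest l) = fun x => behead (pden l x).
Proof. by rewrite /trest -lock; apply: functional_extensionality => x /=; case: (pden l x). Qed.

End Equations.
End Combinators.

Arguments v0 {G A}.
Arguments weak {G A B} p.
Arguments tfst {G A B} p.
Arguments tsnd {G A B} p.
Arguments app2 {G A B C} p x y.
Arguments tunit {G A} p.
Arguments ttrue {G}.
Arguments tfalse {G}.
Local Notation v1 := (weak v0).
Local Notation v2 := (weak v1).
Local Notation v3 := (weak v2).
Local Notation "'<<' x ',' y '>>'" := (PPair x y) (at level 0).

Section Lists.
Variables (G : ty).
Implicit Types (A B : ty).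

Definition tnil A : prog G (TList A) := tunit (PNil A).
Definition tcons A (x : prog G A) (l : prog G (TList A)) : prog G (TList A) :=
  app2 (PCons A) x l.
Definition t1 A (x : prog G A) : prog G (TList A) := tcons x (tnil A).
Definition tmap A B (l : prog G (TList A)) (f : prog (TProd G A) B) : prog G (TList B) :=
  locked (tfoldr l (tnil B) (app2 (PCons B) (weak f) v0)).
Definition tcat A (l m : prog G (TList A)) : prog G (TList A) :=
  locked (tfoldr l m (app2 (PCons A) v1 v0)).
Definition tfilter A (l : prog G (TList A)) (f : prog (TProd G A) TBool) :
  prog G (TList A) :=
  locked (tfoldr l (tnil A) (tif (weak f) (app2 (PCons A) v1 v0) v0)).
Definition tall A (l : prog G (TList A)) (f : prog (TProd G A) TBool) : prog G TBool :=
  locked (tfoldr l ttrue (tif (weak f) v0 tfalse)).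
Definition thas A (l : prog G (TList A)) (f : prog (TProd G A) TBool) : prog G TBool :=
  locked (tfoldr l tfalse (tif (weak f) ttrue v0)).
Definition tfind A (l : prog G (TList A)) (f : prog (TProd G A) TBool) : prog G TNat :=
  locked (tfoldr l (tunit PO) (tif (weak f) (tunit PO) (PComp PSucc v0))).
Definition tlength A (l : prog G (TList A)) : prog G TNat :=
  locked (tfoldr l (tunit PO) (PComp PSucc v0)).
Definition tnot (b : prog G TBool) :=
  locked (tif b tfalse ttrue).
Definition tand (b b' : prog G TBool) :=
  locked (tif b b' tfalse).
Definition tor (b b' : prog G TBool) :=
  locked (tif b ttrue b').

Section Equations.
Variables (S : comNzRingType) (dvd : rel S).
Local Notation pden := (pden dvd).
Local Notation holds := (holds dvd).

Lemma tmapE A B (l : prog G (TList A)) (f : prog (TProd G A) B) :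
  pden (tmap l f) = fun x => [seq pden f (x, a) | a <- pden l x].
Proof. by rewrite /tmap -lock tfoldrE. Qed.

Lemma tcatE A (l m : prog G (TList A)) : pden (tcat l m) = fun x => pden l x ++ pden m x.
Proof.
rewrite /tcat -lock tfoldrE; apply: functional_extensionality => x /=.
by elim: (pden l x) => //= a t ->.
Qed.

Lemma tfilterE A (l : prog G (TList A)) f :
  pden (tfilter l f) = fun x => [seq a <- pden l x | holds f (x, a)].
Proof.
rewrite /tfilter -lock tfoldrE tifE; apply: functional_extensionality => x /=.
by elim: (pden l x) => //= a t ->.
Qed.

Lemma holds_tall A (l : prog G (TList A)) f :
  holds (tall l f) = fun x => all (fun a => holds f (x, a)) (pden l x).
Proof.
apply: functional_extensionality => x; rewrite /tall -lock [in LHS]/holds tfoldrE tifE /=.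
elim: (pden l x) => //= a t <-; rewrite /weak holds_comp /=.
by case: ifP.
Qed.

Lemma holds_thas A (l : prog G (TList A)) f :
  holds (thas l f) = fun x => has (fun a => holds f (x, a)) (pden l x).
Proof.
apply: functional_extensionality => x; rewrite /thas -lock [in LHS]/holds tfoldrE tifE /=.
elim: (pden l x) => //= a t <-; rewrite /weak holds_comp /=.
by case: ifP.
Qed.

Lemma tfindE A (l : prog G (TList A)) f :
  pden (tfind l f) = fun x => find (fun a => holds f (x, a)) (pden l x).
Proof.
apply: functional_extensionality => x; rewrite /tfind -lock tfoldrE tifE /=.
by elim: (pden l x) => //= a t ->.
Qed.

Lemma tlengthE A (l : prog G (TList A)) : pden (tlength l) = fun x => size (pden l x).
Proof.
apply: functional_extensionality => x; rewrite /tlength -lock tfoldrE /=.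
by elim: (pden l x) => //= a t ->.
Qed.

Lemma holds_tnot b : holds (tnot b) = fun x => ~~ holds b x.
Proof.
rewrite /tnot -lock holds_tif holds_true holds_false.
by apply: functional_extensionality => x; case: ifP.
Qed.
Lemma holds_tand b b' : holds (tand b b') = fun x => holds b x && holds b' x.
Proof. by rewrite /tand -lock holds_tif holds_false. Qed.
Lemma holds_tor b b' : holds (tor b b') = fun x => holds b x || holds b' x.
Proof. by rewrite /tor -lock holds_tif holds_true. Qed.

End Equations.
End Lists.

Definition tflat G A (l : prog G (TList (TList A))) : prog G (TList A) :=
  locked (tfoldr l (tnil G A) (tcat v1 v0)).
Lemma tflatE S dvd G A (l : prog G (TList (TList A))) :
  @pden S dvd _ _ (tflat l) = fun x => flatten (pden dvd l x).
Proof. by rewrite /tflat -lock tfoldrE tcatE. Qed.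

Lemma nat_primrec_succ a b : nat_primrec a (fun _ n => n.+1) b = (a + b)%N.
Proof. by elim: b => [|b /= ->]; rewrite ?addn0 ?addnS. Qed.

Section Nat.
Variables (G : ty).
Definition tO : prog G TNat := tunit PO.
Definition tS (n : prog G TNat) : prog G TNat := PComp PSucc n.
Definition tpred (n : prog G TNat) : prog G TNat :=
  locked (trec n tO v1).
Definition tadd (m n : prog G TNat) :=
  locked (trec n m (PComp PSucc v0)).
Definition tmul (m n : prog G TNat) :=
  locked (trec n tO (trec (weak (weak m)) v0 (PComp PSucc v0))).
Definition tiszero (n : prog G TNat) : prog G TBool :=
  locked (trec n ttrue tfalse).

Section Equations.
Variables (S : comNzRingType) (dvd : rel S).
Local Notation pden := (pden dvd).
Local Notation holds := (holds dvd).

Lemma tpredE n : pden (tpred n) = fun x => (pden n x).-1.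
Proof. by apply: functional_extensionality => x; rewrite /tpred -lock trecE; case: (pden n x). Qed.

Lemma taddE m n : pden (tadd m n) = fun x => (pden m x + pden n x)%N.
Proof.
apply: functional_extensionality => x; rewrite /tadd -lock trecE /=.
exact: nat_primrec_succ.
Qed.

Lemma tmulE m n : pden (tmul m n) = fun x => (pden m x * pden n x)%N.
Proof.
apply: functional_extensionality => x; rewrite /tmul -lock !trecE /=.
elim: (pden n x) => [|i] /=; rewrite ?muln0 // => ->; rewrite mulnS.
by rewrite nat_primrec_succ addnC.
Qed.

Lemma holds_tiszero n : holds (tiszero n) = fun x => pden n x == 0%N.
Proof.
by apply: functional_extensionality => x; rewrite /tiszero -lock /holds trecE; case: (pden n x).
Qed.
End Equations.
End Nat.

Definition tsub G (m n : prog G TNat) :=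
  locked (trec n m (tpred v0)).
Lemma tsubE S dvd G (m n : prog G TNat) :
  @pden S dvd _ _ (tsub m n) = fun x => (pden dvd m x - pden dvd n x)%N.
Proof.
apply: functional_extensionality => x; rewrite /tsub -lock trecE tpredE /=.
by elim: (pden dvd n x) => [|i] /=; rewrite ?subn0 // => ->; rewrite subnS.
Qed.

Definition teqn G (m n : prog G TNat) :=
  locked (tand (tiszero (tsub m n)) (tiszero (tsub n m))).
Lemma holds_teqn S dvd G (m n : prog G TNat) :
  @holds S dvd _ (teqn m n) = fun x => pden dvd m x == pden dvd n x.
Proof.
apply: functional_extensionality => x; rewrite /teqn -lock holds_tand !holds_tiszero !tsubE.
by rewrite !subn_eq0 -eqn_leq.
Qed.

Definition tnthd G A (x0 : prog G A) l n :=
  locked (tfirst x0 (trec n l (trest v0))).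
Lemma tnthdE S dvd G A (x0 : prog G A) l n :
  @pden S dvd _ _ (tnthd x0 l n) = fun x => nth (pden dvd x0 x) (pden dvd l x) (pden dvd n x).
Proof.
apply: functional_extensionality => x; rewrite /tnthd -lock tfirstE trecE trestE /=.
have -> : nat_primrec (pden dvd l x) (fun=> behead) (pden dvd n x)
  = drop (pden dvd n x) (pden dvd l x).
  elim: (pden dvd n x) => [|i /= ->]; first by rewrite drop0.
  by rewrite -drop1 drop_drop.
by rewrite -nth0 nth_drop addn0.
Qed.

Definition tmkseq G A (n : prog G TNat) (f : prog (TProd G TNat) A) : prog G (TList A) :=
  locked (trec n (tnil G A) (tcat v0 (t1 (weak f)))).
Lemma tmkseqE S dvd G A (n : prog G TNat) (f : prog (TProd G TNat) A) :
  @pden S dvd _ _ (tmkseq n f) = fun x => mkseq (fun i => pden dvd f (x, i)) (pden dvd n x).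
Proof.
apply: functional_extensionality => x; rewrite /tmkseq -lock trecE tcatE /=.
by elim: (pden dvd n x) => //= i ->; rewrite cats1 -mkseqS.
Qed.

Definition tmaxsat G (n : prog G TNat) (f : prog (TProd G TNat) TBool) : prog G TNat :=
  locked (trec n (tO G) (tif (PComp f (PPair (PComp (PFst _ _) (PFst _ _)) (PComp PSucc v1)))
                     (PComp PSucc v1) v0)).
Lemma tmaxsatE S dvd G (n : prog G TNat) (f : prog (TProd G TNat) TBool) :
  @pden S dvd _ _ (tmaxsat n f) = fun x => maxsat (fun i => holds dvd f (x, i)) (pden dvd n x).
Proof. by rewrite /tmaxsat -lock trecE tifE holds_comp. Qed.

Local Notation u1 := (PFst _ _).
Local Notation u2 := (weak u1).
Local Notation u3 := (weak u2).
Local Notation u4 := (weak u3).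
Local Notation u5 := (weak u4).
Local Notation u6 := (weak u5).
Local Notation v4 := (weak v3).
Local Notation v5 := (weak v4).

Lemma holds_weak S dvd G A (p : prog G TBool) :
  @holds S dvd (TProd G A) (weak p) = fun x => holds dvd p x.1.
Proof. by []. Qed.
Lemma holds_PEq S dvd : @holds S dvd _ PEq = fun x => x.1 == x.2.
Proof. by apply: functional_extensionality => x; rewrite /holds /=; case: (_ == _). Qed.
Lemma holds_PDvd S dvd : @holds S dvd _ PDvd = fun x => dvd x.1 x.2.
Proof. by apply: functional_extensionality => x; rewrite /holds /=; case: (dvd _ _). Qed.

Ltac den := repeat (progress (rewrite ?(tifE, holds_tif, holds_comp, holds_weak,
  holds_PEq, holds_PDvd, tfoldrE, trecE,
  tfirstE, trestE, tmapE, tcatE, tfilterE, holds_tall, holds_thas, tfindE, tlengthE,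
  holds_tnot, holds_tand, holds_tor, tflatE) ?(tpredE, taddE, tmulE, holds_tiszero,
  tsubE, holds_teqn, tnthdE, tmkseqE, tmaxsatE) /=)).

Lemma nat_primrec_iter (A : Type) (f : A -> A) z n :
  nat_primrec z (fun _ => f) n = iter n f z.
Proof. by elim: n => //= n ->. Qed.

Lemma mkseq_const (A : Type) (x : A) n : mkseq (fun _ => x) n = nseq n x.
Proof.
apply: (@eq_from_nth _ x) => [|i]; rewrite size_mkseq ?size_nseq // => lt.
by rewrite nth_mkseq // nth_nseq lt.
Qed.

(** * Transcription of the symbolic algorithm into programs *)

Definition TF := TProd TIntPoly TIntPoly.
Definition TSP := TList (TProd (TList TNat) TF).
Definition TE := TProd TSP (TProd TValue (TList TValue)).
Definition TSys := TList (TProd TNat TSP).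
Definition TC := TList TRing.

Definition i0 G : prog G TIntPoly := tunit PIZero.
Definition i1 G : prog G TIntPoly := tunit PIOne.
Definition tf0 G : prog G TF := << i0 G, i1 G >>.
Definition tf1 G : prog G TF := << i1 G, i1 G >>.
Arguments i0 {G}. Arguments i1 {G}. Arguments tf0 {G}. Arguments tf1 {G}.

Definition p_fmul : prog (TProd TF TF) TF :=
  locked (<< app2 PIMul (tfst u1) (tfst v0), app2 PIMul (tsnd u1) (tsnd v0) >>).
Lemma p_fmulE S dvd : @pden S dvd _ _ p_fmul = fun z => fmul z.1 z.2.
Proof. by rewrite /p_fmul -lock. Qed.

Definition p_fadd : prog (TProd TF TF) TF :=
  locked (<< app2 PIAdd (app2 PIMul (tfst u1) (tsnd v0)) (app2 PIMul (tfst v0) (tsnd u1)),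
     app2 PIMul (tsnd u1) (tsnd v0) >>).
Lemma p_faddE S dvd : @pden S dvd _ _ p_fadd = fun z => fadd z.1 z.2.
Proof. by rewrite /p_fadd -lock. Qed.

Definition p_fexp : prog (TProd TF TNat) TF :=
  locked (trec v0 tf1 (app2 p_fmul u3 v0)).
Lemma p_fexpE S dvd : @pden S dvd _ _ p_fexp = fun z => fexp z.1 z.2.
Proof. rewrite /p_fexp -lock; den; rewrite p_fmulE; apply: functional_extensionality => z; exact: nat_primrec_iter. Qed.

Definition p_vmul : prog (TProd TValue TValue) TValue :=
  locked (<< tmul (tfst u1) (tfst v0),
     app2 p_fmul (app2 p_fexp (tsnd u1) (tfst v0)) (app2 p_fexp (tsnd v0) (tfst u1)) >>).
Lemma p_vmulE S dvd : @pden S dvd _ _ p_vmul = fun z => vmul z.1 z.2.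
Proof. by rewrite /p_vmul -lock; den; rewrite ?(p_fmulE, p_fexpE). Qed.

Definition p_vexp : prog (TProd TValue TNat) TValue :=
  locked (<< tfst u1, app2 p_fexp (tsnd u1) v0 >>).
Lemma p_vexpE S dvd : @pden S dvd _ _ p_vexp = fun z => vexp z.1 z.2.
Proof. by rewrite /p_vexp -lock; den; rewrite ?(p_fexpE). Qed.

Definition tspcst G (x : prog G TF) : prog G TSP := t1 << tnil _ _, x >>.
Definition tspvar G (i : prog G TNat) : prog G TSP := t1 << t1 i, tf1 >>.

Definition p_spmul : prog (TProd TSP TSP) TSP :=
  locked (tflat (tmap u1 (tmap v1 << tcat (tfst v1) (tfst v0), app2 p_fmul (tsnd v1) (tsnd v0) >>))).
Lemma p_spmulE S dvd : @pden S dvd _ _ p_spmul = fun z => spmul z.1 z.2.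
Proof. by rewrite /p_spmul -lock; den; rewrite ?(p_fmulE). Qed.

Definition p_spopp : prog TSP TSP :=
  locked (app2 p_spmul (tspcst << PComp PIOpp i1, i1 >>) (PId _)).
Lemma p_spoppE S dvd : @pden S dvd _ _ p_spopp = fun z => spopp z.
Proof. by rewrite /p_spopp -lock; den; rewrite ?(p_spmulE). Qed.

Definition p_spexp : prog (TProd TSP TNat) TSP :=
  locked (trec v0 (tspcst tf1) (app2 p_spmul u3 v0)).
Lemma p_spexpE S dvd : @pden S dvd _ _ p_spexp = fun z => spexp z.1 z.2.
Proof. rewrite /p_spexp -lock; den; rewrite p_spmulE; apply: functional_extensionality => z; exact: nat_primrec_iter. Qed.

Definition p_strip : prog (TProd TNat (TList TNat)) (TList TNat) :=
  locked (tfilter v0 (tnot (teqn v0 u2))).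
Lemma p_stripE S dvd : @pden S dvd _ _ p_strip = fun z => strip z.1 z.2.
Proof. by rewrite /p_strip -lock; den. Qed.

Definition p_degin : prog (TProd TNat (TList TNat)) TNat :=
  locked (tlength (tfilter v0 (teqn v0 u2))).
Lemma p_deginE S dvd : @pden S dvd _ _ p_degin = fun z => deg_in z.1 z.2.
Proof. rewrite /p_degin -lock; den; apply: functional_extensionality => z; exact: size_filter. Qed.

Definition p_coefin : prog (TProd (TProd TNat TNat) TSP) TSP :=
  locked (tmap (tfilter v0 (teqn (app2 p_degin u3 (tfst v0)) v2))
       << app2 p_strip u3 (tfst v0), tsnd v0 >>).
Lemma p_coefinE S dvd : @pden S dvd _ _ p_coefin = fun z => coef_in z.1.1 z.1.2 z.2.
Proof. by rewrite /p_coefin -lock; den; rewrite ?(p_stripE, p_deginE). Qed.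

Definition p_maxlen : prog TSP TNat :=
  locked (tlength (tflat (tmap (PId _) (tfst v0)))).
Lemma p_maxlenE S dvd : @pden S dvd _ _ p_maxlen = fun z => maxlen z.
Proof. by rewrite /p_maxlen -lock; den. Qed.

Definition TPick := TProd TIntPoly (TProd TNat (TList TNat)).
Definition tapp3 G A B C D (p : prog (TProd (TProd A B) C) D) x y z : prog G D :=
  PComp p << << x, y >>, z >>.
Definition tapp4 G A B C D E (p : prog (TProd (TProd (TProd A B) C) D) E) x y z t :
  prog G E := PComp p << << << x, y >>, z >>, t >>.

(** [PListRec] is used directly, since [picks] needs the tail of the list, which [tfoldr]
    discards. *)
Definition p_picks : prog (TList TNat) (TList TPick) :=
  locked (PComp (PListRec (tnil TUnit TPick)
    (tcons << i1, << PComp u1 (PSnd _ _), PComp u1 (PComp (PSnd _ _) (PSnd _ _)) >> >>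
       (tmap (PComp (PSnd _ _) (PComp (PSnd _ _) (PSnd _ _)))
          << PComp PIOpp (tfst v0), << tfst (tsnd v0),
             tcons (weak (PComp u1 (PSnd _ _))) (tsnd (tsnd v0)) >> >>)))
    << PTt _, PId _ >>).
Lemma p_picksE S dvd : @pden S dvd _ _ p_picks = fun z => picks z.
Proof. rewrite /p_picks -lock /=; den; apply: functional_extensionality => z.
by elim: z => //= a l ->. Qed.

Definition texpand G (row : prog (TProd G TNat) TSP)
    (st : prog G (TList (TProd TSP (TList TNat)))) :=
  locked (tflat (tmap st (tmap (PComp p_picks (tsnd v0))
    << app2 p_spmul (app2 p_spmul (tspcst << tfst v0, i1 >>) (tfst v1))
         (PComp row << PComp u1 u1, tfst (tsnd v0) >>),
       tsnd (tsnd v0) >>))).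
Lemma texpandE S dvd G (row : prog (TProd G TNat) TSP) st :
  @pden S dvd _ _ (texpand row st)
  = fun x => expand (fun l => pden dvd row (x, l)) (pden dvd st x).
Proof. by rewrite /texpand -lock; den; rewrite p_picksE p_spmulE. Qed.

Definition p_mulx : prog (TProd (TProd (TProd TNat TSP) TNat) (TList TSP)) (TList TSP) :=
  locked (tmkseq v1 (tcat (tnthd (tnil _ _) (tcons (tnil _ _) v1) v0)
    (app2 p_spmul (PComp p_spopp (tnthd (tnil _ _) v1 (tpred v2)))
                  (tapp3 p_coefin u4 v0 v3)))).
Lemma p_mulxE S dvd : @pden S dvd _ _ p_mulx = fun z => mulx z.1.1.1 z.1.1.2 z.1.2 z.2.
Proof. by rewrite /p_mulx -lock; den; rewrite ?(p_spmulE, p_spoppE, p_coefinE). Qed.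

Definition p_xpow : prog (TProd (TProd (TProd TNat TSP) TNat) TNat) (TList TSP) :=
  locked (trec v0 (tmkseq v1 (tif (tiszero v0) (tspcst tf1) (tnil _ _)))
    (tapp4 p_mulx u5 v4 v3 v0)).
Lemma p_xpowE S dvd : @pden S dvd _ _ p_xpow = fun z => xpow z.1.1.1 z.1.1.2 z.1.2 z.2.
Proof. rewrite /p_xpow -lock; den; rewrite p_mulxE; apply: functional_extensionality => z; exact: nat_primrec_iter. Qed.

Definition p_hrow : prog (TProd (TProd (TProd (TProd (TProd TNat TSP) TNat) TSP) TNat) TNat) TSP :=
  locked (tflat (tmap v2 (app2 p_spmul (t1 << app2 p_strip u6 (tfst v0), tsnd v0 >>)
     (tnthd (tnil _ _) (tapp4 p_xpow u6 v5 v4 (tadd (app2 p_degin u6 (tfst v0)) v2)) v1)))).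
Lemma p_hrowE S dvd : @pden S dvd _ _ p_hrow = fun z => hrow z.1.1.1.1.1 z.1.1.1.1.2 z.1.1.1.2 z.1.1.2 z.1.2 z.2.
Proof. by rewrite /p_hrow -lock; den; rewrite ?(p_spmulE, p_stripE, p_xpowE, p_deginE). Qed.

Definition p_norm_at : prog (TProd (TProd (TProd TNat TSP) TNat) TSP) TSP :=
  locked (tflat (tmap (trec v1 (t1 << tspcst tf1, tmkseq v1 v0 >>)
    (texpand (PComp p_hrow << << << << << u6, v5 >>, v4 >>, v3 >>, v2 >>, v0 >>) v0)) (tfst v0))).
Lemma p_norm_atE S dvd : @pden S dvd _ _ p_norm_at = fun z => norm_at z.1.1.1 z.1.1.2 z.1.2 z.2.
Proof. rewrite /p_norm_at -lock; den; rewrite texpandE /= p_hrowE; apply: functional_extensionality => z.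
by rewrite /norm_at /mkseq map_id. Qed.

Definition p_is0 : prog (TProd TC TIntPoly) TBool :=
  locked (app2 PEq (app2 PIEval u1 v0) (PComp PZero (PTt _))).
Lemma p_is0E S dvd : @holds S dvd _ p_is0 = fun z => is0 z.1 z.2.
Proof. by rewrite /p_is0 -lock; den. Qed.

Definition p_fle : prog (TProd (TProd TC TF) TF) TBool :=
  locked (app2 PDvd (app2 PIEval u2 (app2 PIMul (tfst v1) (tsnd v0)))
            (app2 PIEval u2 (app2 PIMul (tfst v0) (tsnd v1)))).
Lemma p_fleE S dvd : @holds S dvd _ p_fle = fun z => fle dvd z.1.1 z.1.2 z.2.
Proof. by rewrite /p_fle -lock; den. Qed.

Definition p_feq : prog (TProd (TProd TC TF) TF) TBool :=
  locked (tand (tapp3 p_fle u2 v1 v0) (tapp3 p_fle u2 v0 v1)).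
Lemma p_feqE S dvd : @holds S dvd _ p_feq = fun z => feq dvd z.1.1 z.1.2 z.2.
Proof. by rewrite /p_feq -lock; den; rewrite ?(p_fleE). Qed.

Definition p_veqb : prog (TProd (TProd TC TValue) TValue) TBool :=
  locked (tapp3 p_feq u2 (app2 p_fexp (tsnd v1) (tfst v0)) (app2 p_fexp (tsnd v0) (tfst v1))).
Lemma p_veqbE S dvd : @holds S dvd _ p_veqb = fun z => veqb dvd z.1.1 z.1.2 z.2.
Proof. by rewrite /p_veqb /tapp3 -lock; den; rewrite p_feqE /= p_fexpE. Qed.

Definition p_pure : prog (TProd (TProd (TProd TC TNat) TNat) TSP) TF :=
  locked (tfoldr (tmap (tfilter (tapp3 p_coefin v2 v1 v0)
       (tand (tiszero (tlength (tfst v0))) (tnot (app2 p_is0 u4 (tsnd (tsnd v0))))))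
     (tsnd v0)) tf0 (app2 p_fadd v1 v0)).
Lemma p_pureE S dvd : @pden S dvd _ _ p_pure = fun z => pure_coef z.1.1.1 z.1.1.2 z.1.2 z.2.
Proof. rewrite /p_pure -lock; den; rewrite p_is0E p_coefinE p_faddE; apply: functional_extensionality => z.
rewrite /pure_coef /=; congr (foldr _ _ (map _ _)); apply: eq_filter => t.
by rewrite size_eq0. Qed.

Definition p_pdeg : prog (TProd (TProd TC TNat) TSP) TNat :=
  locked (tmaxsat (PComp p_maxlen v0) (tnot (app2 p_is0 u3 (tfst (tapp4 p_pure u3 v2 v0 v1))))).
Lemma p_pdegE S dvd : @pden S dvd _ _ p_pdeg = fun z => pdeg z.1.1 z.1.2 z.2.
Proof. by rewrite /p_pdeg -lock; den; rewrite ?(p_is0E, p_pureE, p_maxlenE). Qed.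

Definition p_norm : prog (TProd (TProd TC TSys) TSP) TSP :=
  locked (tfoldr v1 v0 (tapp4 p_norm_at (tfst v1) (tsnd v1)
    (tapp3 p_pdeg u4 (tfst v1) (tsnd v1)) v0)).
Lemma p_normE S dvd : @pden S dvd _ _ p_norm = fun z => norm_all z.1.1 z.1.2 z.2.
Proof. by rewrite /p_norm -lock; den; rewrite ?(p_norm_atE, p_pdegE). Qed.

(** The composition serves as a local definition: the norm is put in the context and used for the
    bound and for the coefficients. *)
Definition p_charp : prog (TProd (TProd (TProd TC TSys) TNat) TSP) (TList TF) :=
  locked (PComp (tmkseq (tS (PComp p_maxlen v0)) (tapp4 p_pure u3 v2 v0 v1))
    << << u3, v1 >>, tapp3 p_norm u3 v2 (tcat (tspvar v1) (PComp p_spopp v0)) >>).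
Lemma p_charpE S dvd : @pden S dvd _ _ p_charp = fun z => charp z.1.1.1 z.1.1.2 z.1.2 z.2.
Proof. by rewrite /p_charp -lock; den; rewrite ?(p_maxlenE, p_pureE, p_normE, p_spoppE). Qed.

Definition p_weights : prog (TProd (TList TF) TValue) (TList TF) :=
  locked (tmkseq (tlength u1) (app2 p_fmul (app2 p_fexp (tnthd tf0 u2 v0) (tfst v1))
    (app2 p_fexp << tsnd (tsnd v1), tfst (tsnd v1) >> v0))).
Lemma p_weightsE S dvd : @pden S dvd _ _ p_weights = fun z => weights z.1 z.2.
Proof. by rewrite /p_weights -lock; den; rewrite ?(p_fmulE, p_fexpE). Qed.

Definition p_ismin : prog (TProd (TProd TC (TList TF)) TF) TBool :=
  locked (tall v1 (tapp3 p_fle u3 v1 v0)).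
Lemma p_isminE S dvd : @holds S dvd _ p_ismin = fun z => ismin dvd z.1.1 z.1.2 z.2.
Proof. by rewrite /p_ismin -lock; den; rewrite ?(p_fleE). Qed.

Definition p_mult : prog (TProd (TProd TC (TList TF)) TValue) TNat :=
  locked (PComp (tsub (tmaxsat (tlength v0) (tapp3 p_ismin u2 v1 (tnthd tf0 v1 v0)))
              (tfind v0 (tapp3 p_ismin u2 v1 v0)))
    << u2, app2 p_weights v1 v0 >>).
Lemma p_multE S dvd : @pden S dvd _ _ p_mult = fun z => mult dvd z.1.1 z.1.2 z.2.
Proof. by rewrite /p_mult /tapp3 -lock; den; rewrite p_isminE /= p_weightsE; apply: functional_extensionality => z; rewrite size_mkseq. Qed.

Definition p_slope : prog (TProd (TProd (TProd TC TF) TF) TNat) (TList TValue) :=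
  locked (tif (tor (app2 p_is0 u3 (tfst v2)) (app2 p_is0 u3 (tfst v1))) (tnil _ _)
     (t1 << v0, app2 p_fmul << tsnd v2, tfst v2 >> v1 >>)).
Lemma p_slopeE S dvd : @pden S dvd _ _ p_slope = fun z => slope z.1.1.1 z.1.1.2 z.1.2 z.2.
Proof. by rewrite /p_slope -lock; den; rewrite ?(p_is0E, p_fmulE). Qed.

Definition p_slopes : prog (TProd TC (TList TF)) (TList TValue) :=
  locked (tflat (tmkseq (tlength v0) (tflat (tmkseq (tlength v1)
     (tapp4 p_slope u3 (tnthd tf0 v2 v1) (tnthd tf0 v2 (tadd v1 (tS v0))) (tS v0)))))).
Lemma p_slopesE S dvd : @pden S dvd _ _ p_slopes = fun z => slopes z.1 z.2.
Proof. by rewrite /p_slopes -lock; den; rewrite ?(p_slopeE). Qed.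

Definition p_undupv : prog (TProd TC (TList TValue)) (TList TValue) :=
  locked (tfoldr v0 (tnil _ _) (tif (thas v0 (tapp3 p_veqb u4 v2 v0)) v0 (tcons v1 v0))).
Lemma p_undupvE S dvd : @pden S dvd _ _ p_undupv = fun z => undupv dvd z.1 z.2.
Proof. by rewrite /p_undupv -lock; den; rewrite ?(p_veqbE). Qed.

Definition p_lowest : prog (TProd TC (TList TF)) TNat :=
  locked (tfind v0 (tnot (app2 p_is0 u2 (tfst v0)))).
Lemma p_lowestE S dvd : @pden S dvd _ _ p_lowest = fun z => lowest z.1 z.2.
Proof. by rewrite /p_lowest -lock; den; rewrite ?(p_is0E). Qed.

Definition p_cofactor : prog (TProd (TProd TC (TList TF)) TSP) TSP :=
  locked (tflat (tmkseq (tlength v1) (app2 p_spmul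
     (tspcst (tnthd tf0 v2 (tadd (app2 p_lowest u3 v2) v0))) (app2 p_spexp v1 v0)))).
Lemma p_cofactorE S dvd : @pden S dvd _ _ p_cofactor = fun z => cofactor_at0 z.1.1 z.1.2 z.2.
Proof. by rewrite /p_cofactor -lock; den; rewrite ?(p_spmulE, p_lowestE, p_spexpE). Qed.

Definition tone G : prog G TNat := tS (tO G).

Definition p_entries : prog (TProd (TProd TC (TList TF)) TSP) (TList TE) :=
  locked (tcat (tmap (app2 p_undupv u2 (app2 p_slopes u2 v1)) << v1, << v0, t1 v0 >> >>)
    (t1 << tapp3 p_cofactor u2 v1 v0,
       << << tone _, << tsnd (tnthd tf0 v1 (app2 p_lowest u2 v1)),
                        tfst (tnthd tf0 v1 (app2 p_lowest u2 v1)) >> >>,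
          t1 << tone _, << i1, i0 >> >> >> >>)).
Lemma p_entriesE S dvd : @pden S dvd _ _ p_entries = fun z => entries dvd z.1.1 z.1.2 z.2.
Proof. by rewrite /p_entries -lock; den; rewrite ?(p_undupvE, p_slopesE, p_cofactorE, p_lowestE). Qed.

Definition p_merge : prog (TProd (TProd TNat TE) TE) TE :=
  locked (<< app2 p_spmul (tfst v1) (app2 p_spexp (tfst v0) u2),
     << app2 p_vmul (tfst (tsnd v1)) (app2 p_vexp (tfst (tsnd v0)) u2),
        tcat (tsnd (tsnd v1)) (tsnd (tsnd v0)) >> >>).
Lemma p_mergeE S dvd : @pden S dvd _ _ p_merge = fun z => merge_entries z.1.1 z.1.2 z.2.
Proof. by rewrite /p_merge -lock; den; rewrite ?(p_spmulE, p_spexpE, p_vmulE, p_vexpE). Qed.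

Definition tpairs G A B (s : prog G (TList A)) (t : prog G (TList B)) :=
  locked (tflat (tmap s (tmap (weak t) << v1, v0 >>))).
Lemma tpairsE S dvd G A B (s : prog G (TList A)) (t : prog G (TList B)) :
  @pden S dvd _ _ (tpairs s t) = fun x => pairs (pden dvd s x) (pden dvd t x).
Proof. by rewrite /tpairs -lock; den. Qed.

Definition p_separates : prog (TProd (TProd TC TNat) (TProd (TProd TE TE) (TProd TE TE))) TBool :=
  locked (tor (tnot (tapp3 p_veqb u2
      (tfst (tsnd (tapp3 p_merge v1 (tfst (tfst v0)) (tsnd (tfst v0)))))
      (tfst (tsnd (tapp3 p_merge v1 (tfst (tsnd v0)) (tsnd (tsnd v0)))))))
    (tand (tapp3 p_veqb u2 (tfst (tsnd (tfst (tfst v0)))) (tfst (tsnd (tfst (tsnd v0)))))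
          (tapp3 p_veqb u2 (tfst (tsnd (tsnd (tfst v0)))) (tfst (tsnd (tsnd (tsnd v0))))))).
Lemma p_separatesE S dvd : @holds S dvd _ p_separates = fun z => separates dvd z.1.1 z.1.2 z.2.
Proof. rewrite /p_separates /tapp3 -lock; den; rewrite p_veqbE /= p_mergeE; apply: functional_extensionality => z.
by rewrite /separates implybE. Qed.

Definition p_sep_exponent : prog (TProd (TProd TC (TList TE)) (TList TE)) TNat :=
  locked (tmaxsat (tS (tlength (tpairs (tpairs v1 v0) (tpairs v1 v0))))
    (tall (tpairs (tpairs v2 v1) (tpairs v2 v1)) (tapp3 p_separates u4 v1 v0))).
Lemma p_sep_exponentE S dvd : @pden S dvd _ _ p_sep_exponent = fun z => sep_exponent dvd z.1.1 z.1.2 z.2.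
Proof. by rewrite /p_sep_exponent /tapp3 -lock; den; rewrite !tpairsE p_separatesE ?tpairsE. Qed.

Definition p_combine : prog (TProd (TProd TC (TList TE)) (TList TE)) (TList TE) :=
  locked (tmap (tpairs v1 v0) (tapp3 p_merge (tapp3 p_sep_exponent u3 v2 v1) (tfst v0) (tsnd v0))).
Lemma p_combineE S dvd : @pden S dvd _ _ p_combine = fun z => combine dvd z.1.1 z.1.2 z.2.
Proof. by rewrite /p_combine -lock; den; rewrite p_mergeE p_sep_exponentE tpairsE. Qed.

Definition p_joint : prog (TProd (TProd (TProd TC TSys) TNat) (TList TSP)) (TList TE) :=
  locked (tfoldr v0 (t1 << tspcst tf1, << << tone _, tf1 >>, tnil _ _ >> >>)
    (tapp3 p_combine u5 (tapp3 p_entries u5 (tapp4 p_charp u5 v4 v3 v1) v1) v0)).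
Lemma p_jointE S dvd : @pden S dvd _ _ p_joint = fun z => joint dvd z.1.1.1 z.1.1.2 z.1.2 z.2.
Proof. by rewrite /p_joint -lock; den; rewrite ?(p_combineE, p_entriesE, p_charpE). Qed.

Definition p_values : prog (TProd (TProd (TProd TC TSys) TNat) (TList TSP)) TOutput :=
  locked (tflat (tmap (tapp4 p_joint u3 v2 v1 v0)
    (tmkseq (tapp3 p_mult u4 (tapp4 p_charp u4 v3 v2 (tfst v0)) (tfst (tsnd v0)))
            (tsnd (tsnd v1))))).
Lemma p_valuesE S dvd : @pden S dvd _ _ p_values = fun z => values dvd z.1.1.1 z.1.1.2 z.1.2 z.2.
Proof. rewrite /p_values -lock; den; rewrite p_jointE p_multE p_charpE; apply: functional_extensionality => z.
rewrite /values; congr flatten; apply: eq_map => e; exact: mkseq_const. Qed.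

Definition p_symbolic : prog (TProd TC TPoly) TSP :=
  locked (tmap v0 << tflat (tmkseq (tlength (tfst v0)) (tmkseq (tnthd (tO _) (tfst v1) v0) v1)),
    << PComp PIVar (tfind u2 (app2 PEq v0 (tfst (tsnd v1)))),
       PComp PIVar (tfind u2 (app2 PEq v0 (tsnd (tsnd v1)))) >> >>).
Lemma p_symbolicE S dvd : @pden S dvd _ _ p_symbolic = fun z => symbolic z.1 z.2.
Proof. rewrite /p_symbolic -lock; den; apply: functional_extensionality => z.
apply: eq_map => t; congr (_, _); congr flatten; apply: eq_map => i; exact: mkseq_const. Qed.

Definition p_coefficients : prog TInput TC :=
  locked (tflat (tmap (tcat u1 v0) (tflat (tmap v0 (tcons (tfst (tsnd v0)) (t1 (tsnd (tsnd v0)))))))).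
Lemma p_coefficientsE S dvd : @pden S dvd _ _ p_coefficients = fun z => coefficients z.
Proof. by rewrite /p_coefficients -lock; den. Qed.

Definition p_solve : prog TInput TOutput :=
  locked (PComp (tapp4 p_values u1
      (tmkseq (tlength (tfst v0)) << v0, app2 p_symbolic u2 (tnthd (tnil _ _) (tfst v1) v0) >>)
      (tlength (tfst v0))
      (tcat (tmkseq (tlength (tfst v0)) (tspvar v0)) (tmap (tsnd v0) (app2 p_symbolic u2 v0))))
    << p_coefficients, PId _ >>).
Lemma p_solveE S dvd : @pden S dvd _ _ p_solve = fun z => solve dvd z.
Proof. by rewrite /p_solve -lock; den; rewrite ?(p_valuesE, p_symbolicE, p_coefficientsE). Qed.

Theorem mainTheorem3 :
  exists algo : algorithm TInput TOutput,
  forall (K : fieldType) (V : {pred K})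
         (S : comNzRingType) (iota : {rmorphism S -> K}) (dvd : rel S)
         (L : closedFieldType) (phi : {rmorphism K -> L}) (VL : {pred L}),
    is_valuation_ring V ->
    (* S is a subring of V with quotient field K *)
    injective iota ->
    (forall s : S, iota s \in V) ->
    (forall x : K, exists a b : S, b != 0 /\ x = iota a / iota b) ->
    (* dvd tests divisibility in V *)
    (forall a b : S,
       reflect (exists2 c : K, c \in V & iota b = c * iota a) (dvd a b)) ->
    (* L is an algebraic closure of K, and VL extends V *)
    (forall x : L, algebraicOver phi x) ->
    is_valuation_ring VL ->
    (forall x : K, (phi x \in VL) = (x \in V)) ->
  forall (k r : nat) (P : forall i : 'I_k, {mpoly K[i.+1]})
         (Q : 'I_r -> {mpoly K[k]}) (input : tyden S TInput),
    triangular P ->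
    size input.1 = k ->
    size input.2 = r ->
    (forall i : 'I_k, presents iota (nth [::] input.1 i) (P i)) ->
    (forall j : 'I_r, presents iota (nth [::] input.2 j) (Q j)) ->
  let R := root_vectors phi P in
  let tuples := [seq x ++ [seq eval_at phi (Q j) x | j <- enum 'I_r] | x <- R] in
  size R = (\prod_(i < k) main_degree (P i))%N
  /\ exists output : tyden S TOutput,
       outputs dvd algo input output
       /\ exists2 tuples' : seq (seq L), perm_eq tuples' tuples
          & List.Forall2 (List.Forall2 (computes_value (fun s => phi (iota s)) VL
                                (coefficients input)))
              output tuples'.
Proof.
(* The computation is primitive recursive and takes place in [init]; the state is already the
   output, returned by the first step. *)
exists (Algorithm p_solve (PInr TOutput TOutput)).
move=> K V S iota dvd L phi VL _ inj_i _ _ dvdP _ HV VLE k r P Q input.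
move=> triP sz1 sz2 pP pQ.
have [szR [t pt ft]] := solve_correct inj_i dvdP HV VLE triP sz1 sz2 pP pQ.
split=> //; exists (solve dvd input); split; last by exists t.
by exists 1%N; rewrite /= p_solveE.
Qed.
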